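(* Let $d\geq1$ be an integer, $\alpha>\frac d2$ and $b>0$. As $a$, $\beta$ and $\gamma$ tend to infinity such that $\frac{a}{2\sqrt{\beta\gamma}}$ tends to $b$, the Gauss hypergeometric covariance $G_d(\cdot;a,\alpha,\beta,\gamma)$ converges uniformly on $\mathbb{R}^d$ to the Mat\'ern covariance with scale factor $b$ and smoothness parameter $\alpha-\frac d2$: $$\boldsymbol h\mapsto\frac{2}{\Gamma(\alpha-\frac d2)}\left(\frac{\|\boldsymbol h\|}{2b}\right)^{\alpha-\frac d2}K_{\alpha-\frac d2}\left(\frac{\|\boldsymbol h\|}{b}\right),\qquad\boldsymbol h\in\mathbb{R}^d,$$ where $K_{\alpha-\frac d2}$ is the modified Bessel function of the second kind of order $\alpha-\frac d2$ (the value at $\boldsymbol h=\boldsymbol 0$ being $1$, by continuity).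
   Context: For $a>0$, $\alpha>\frac d2$, $\beta>\alpha$, $\gamma>\alpha$, the Gauss hypergeometric covariance is $$G_d(\boldsymbol h;a,\alpha,\beta,\gamma)=\frac{\Gamma(\beta-\frac d2)\Gamma(\gamma-\frac d2)}{\Gamma(\beta-\alpha+\gamma-\frac d2)\Gamma(\alpha-\frac d2)}\left(1-\frac{\|\boldsymbol h\|^2}{a^2}\right)_+^{\beta-\alpha+\gamma-\frac d2-1}{}_2F_1\left(\beta-\alpha,\gamma-\alpha;\beta-\alpha+\gamma-\tfrac d2;\left(1-\tfrac{\|\boldsymbol h\|^2}{a^2}\right)_+\right),\quad\boldsymbol h\in\mathbb{R}^d,$$ where $(x)_+=\max\{x,0\}$ and ${}_2F_1$ is the Gauss hypergeometric function. *)

(* Defs.v *)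
From HB Require Import structures.
From mathcomp Require Import all_boot all_order all_algebra.
From mathcomp Require Import all_classical all_reals all_analysis.
Set Implicit Arguments.
Unset Strict Implicit.
Unset Printing Implicit Defensive.
Import Order.TTheory GRing.Theory Num.Theory.
Import numFieldNormedType.Exports.
Local Open Scope classical_set_scope.
Local Open Scope ring_scope.

(* The library's norm on 'rV[R]_d is the sup norm, hence this definition. *)
Definition enorm (R : realType) (d : nat) (h : 'rV[R]_d) : R :=
  Num.sqrt (\sum_(i < d) h ord0 i ^+ 2).

(* Euler's integral; meaningful for 0 < x. *)
Definition Gamma (R : realType) (x : R) : R :=
  \int[lebesgue_measure]_(t in `]0, +oo[) (t `^ (x - 1) * expR (- t)).

Definition pochhammer (R : realType) (x : R) (n : nat) : R :=
  \prod_(i < n) (x + i%:R).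

(* Gauss series; meaningful (for c > 0) when `|z| < 1, and also at z = 1 when
   c - a - b > 0. In [hypergeometric_cov] one has 0 <= z <= 1 and
   c - a - b = alpha - d/2 > 0. *)
Definition hyp2F1 (R : realType) (a b c z : R) : R :=
  limn (series (fun n : nat =>
    pochhammer a n * pochhammer b n / pochhammer c n * (z ^+ n / n`!%:R))).

Definition cosh (R : realType) (t : R) : R := (expR t + expR (- t)) / 2.

(* Modified Bessel function of the second kind of real order nu, through its
   standard integral representation for x > 0. *)
Definition besselK (R : realType) (nu x : R) : R :=
  \int[lebesgue_measure]_(t in `[0, +oo[) (expR (- (x * cosh t)) * cosh (nu * t)).

(* As 0 `^ r is 0 for r != 0, the power factor vanishes when enorm h >= a,
   except for the exponent 0, where 0 `^ 0 = 1. *)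
Definition hypergeometric_cov (R : realType) (d : nat) (a alpha beta gamma : R)
    (h : 'rV[R]_d) : R :=
  let z := Num.max (1 - enorm h ^+ 2 / a ^+ 2) 0 in
  let c := beta - alpha + gamma - d%:R / 2 in
  Gamma (beta - d%:R / 2) * Gamma (gamma - d%:R / 2)
    / (Gamma c * Gamma (alpha - d%:R / 2))
  * z `^ (c - 1) * hyp2F1 (beta - alpha) (gamma - alpha) c z.

(* Scale b and smoothness nu. The integral defining [besselK] diverges at 0, so
   the value at the origin is given separately. *)
Definition matern_cov (R : realType) (d : nat) (b nu : R) (h : 'rV[R]_d) : R :=
  if h == 0 then 1
  else 2 / Gamma nu * (enorm h / (2 * b)) `^ nu * besselK nu (enorm h / b).

(* Main.v *)
(* Write nu = alpha - d/2, p = beta - d/2, q = gamma - d/2. Expanding 2F1 and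
   integrating term by term (Euler's integral, binomial series) shows that the
   hypergeometric covariance at distance r is the mean of
   (1 - q r^2 / (a^2 t))_+^(p - 1) under the probability density proportional to
   t^(nu - 1) (1 - t/q)_+^(q - nu - 1); the substitution t = (x/2) e^w in the
   Bessel integral shows that the Matern covariance is the mean of
   exp(- r^2 / (4 b^2 t)) under the density proportional to t^(nu - 1) e^(-t).
   With y = r^2 / (4 b^2 t), the first integrand is (1 - k y / (p - 1))_+^(p - 1)
   for k = 4 b^2 (p - 1) q / a^2, which tends to 1, so it is within
   8 / (p - 1) + 2 |k - 1| of e^(-y) for every y >= 0, uniformly in r and t; and
   the L^1 distance of the two weights is O(1/q). *)
Require Import Defs.
From HB Require Import structures.
From mathcomp Require Import all_boot all_order all_algebra.
From mathcomp Require Import all_classical all_reals all_analysis.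
From mathcomp Require Import measurable_realfun ring lra.
Set Implicit Arguments.
Unset Strict Implicit.
Unset Printing Implicit Defensive.
Import Order.TTheory GRing.Theory Num.Theory.
Import numFieldNormedType.Exports.
Local Open Scope classical_set_scope.
Local Open Scope ring_scope.

(** * Change of variables on an exhausted interval *)

(** The limit runs along an arbitrary proper filter [F], to which dominated convergence for
    sequences does not apply directly. Every estimate is therefore an explicit inequality at fixed
    large p and q, and a limit is taken only of a scalar bound free of [h]. The two mixtures live on
    the same half-line and share the factor t^(nu - 1), so their integrands can be compared
    pointwise. Their normalising constants are their own values at distance 0; the convergence of
    these constants is thus an instance of the same estimate, and no asymptotics of the Gamma
    function enter. The covariance is symmetric in beta and gamma, but the mixture is not: q shapes
    the weight and p the integrand. Because of the singularities (t^(nu - 1) at 0 when nu < 1, the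
    Gauss series at z = 1), integrals and series are handled as nonnegative extended reals:
    substitution, Tonelli and term-by-term integration then need no prior integrability, and
    finiteness is read off afterwards. *)

Section substitution.
Context {R : realType}.
Notation mu := (@lebesgue_measure R).
Implicit Types (f g dg : R -> R) (a b : R^nat) (D : set R).

Definition exhausted_by_itvs D :=
  open D /\ exists a b : R^nat, [/\ nonincreasing_seq a, nondecreasing_seq b,
    forall n, a n <= b n & D = \bigcup_n `[a n, b n]%classic].

(** On each compact [[a n, b n]] this is the classical increasing substitution; monotone convergence
    along the exhaustion, on both sides, carries it to intervals at whose ends [f] or [g] may blow
    up. Openness of [D] makes the derivative two-sided even at [a n] and [b n]. *)
Lemma ge0_integration_by_substitution_image g dg f D : exhausted_by_itvs D ->
  (forall x, D x -> is_derive x 1 g (dg x)) ->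
  (forall x, D x -> {for x, continuous dg}) ->
  (forall x, D x -> 0 < dg x) ->
  (forall x, D x -> {for g x, continuous f}) ->
  (forall x, D x -> 0 <= f (g x)) ->
  (\int[mu]_(y in g @` D) (f y)%:E =
   \int[mu]_(x in D) (f (g x) * dg x)%:E)%E.
Proof.
move=> [oD [a [b [na nb ab DE]]]] dgP cdg dg0 cf f0.
have subD n x : `[a n, b n]%classic x -> D x by rewrite DE => nx; exists n.
have gE x : D x -> derive1 g x = dg x by move=> /dgP Dx; rewrite derive1E derive_val.
have cg x : D x -> {for x, continuous g}.
  move=> /dgP Dx; apply/differentiable_continuous/derivable1_diffP.
  exact: ex_derive.
have nearD x : D x -> \near x, D x by move=> Dx; exact: open_nbhs_nbhs.
have cg' x : D x -> derive1 g y @[y --> x] --> derive1 g x.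
  move=> Dx; rewrite gE//; apply: cvg_trans (cdg x Dx).
  apply: near_eq_cvg; near=> y; rewrite gE//.
  by near: y; exact: nearD.
have within_cont n (h : R -> R) : (forall x, D x -> {for x, continuous h}) ->
    {within `[a n, b n], continuous h}.
  move=> ch; apply: continuous_in_subspaceT => x; rewrite inE => /subD; exact: ch.
have incr n : {in `[a n, b n] &, {homo g : x y / x < y}}.
  have := @gtr0_derive1_lt _ g (a n) (b n).
  apply.
  - move=> x xab; apply: ex_derive; apply: dgP.
    apply: (@subD n); exact: subset_itv_oo_cc xab.
  - move=> x xab; have Dx : D x by apply: (@subD n); exact: subset_itv_oo_cc xab.
    by rewrite gE// dg0.
  - exact: within_cont.
have incrW n : {in `[a n, b n] &, {homo g : x y / x <= y}}.
  by apply: ltW_homo_in; exact: incr.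
have in_a m n : (m <= n)%N -> a m \in `[a n, b n].
  by move=> mn; rewrite in_itv/= na//= (le_trans (ab m))// nb.
have in_b m n : (m <= n)%N -> b m \in `[a n, b n].
  by move=> mn; rewrite in_itv/= nb// andbT (le_trans _ (ab m))// na.
have image n y : `[g (a n), g (b n)]%classic y -> exists2 x, `[a n, b n]%classic x & g x = y.
  rewrite /= in_itv/= => yab.
  have [] := @IVT _ g (a n) (b n) y (ab n); last by move=> x xab <-; exists x.
    exact: within_cont.
  have gab : g (a n) <= g (b n) by apply: (incrW n) => //; [exact: in_a|exact: in_b].
  by rewrite minEle maxEle gab.
have -> : g @` D = \bigcup_n `[g (a n), g (b n)]%classic.
  apply/seteqP; split=> [_ [x + <-]|y [n _ /image[x /subD Dx <-]]]; last by exists x.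
  rewrite DE => -[n _ nx]; exists n => //=; move: (nx); rewrite /= in_itv/= => /andP[ax xb].
  by rewrite in_itv/= !(incrW n) ?in_a ?in_b.
have cfy n y : `[g (a n), g (b n)]%classic y -> {for y, continuous f}.
  by move=> /image[x /subD Dx <-]; exact: cf.
have within_cfy n : {within `[g (a n), g (b n)], continuous f}.
  by apply: continuous_in_subspaceT => x; rewrite inE; exact: cfy.
have L : (\int[mu]_(y in `[g (a i), g (b i)]) (f y)%:E)%E @[i --> \oo] -->
    (\int[mu]_(y in \bigcup_n `[g (a n), g (b n)]%classic) (f y)%:E)%E.
  apply: ge0_nondecreasing_set_cvg_integral => //.
  - move=> m n mn; apply/subsetPset; apply: subset_itvScc.
      by apply: (incrW n) => //; [exact: in_a|exact: in_a|exact: na].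
    by apply: (incrW n) => //; [exact: in_b|exact: in_b|exact: nb].
  - move=> n; apply/measurable_EFinP.
    apply: (@subspace_continuous_measurable_fun R `[g (a n), g (b n)]) => //.
  - by move=> n y /image[x /subD Dx <-]; rewrite lee_fin f0.
have Rr : (\int[mu]_(x in `[a i, b i]) (f (g x) * dg x)%:E)%E @[i --> \oo] -->
    (\int[mu]_(x in \bigcup_n `[a n, b n]%classic) (f (g x) * dg x)%:E)%E.
  apply: ge0_nondecreasing_set_cvg_integral => //.
  - by move=> m n mn; apply/subsetPset; apply: subset_itvScc; [exact: na|exact: nb].
  - move=> n; apply/measurable_EFinP.
    apply: (@subspace_continuous_measurable_fun R `[a n, b n]) => //.
    apply: within_cont => x Dx; apply: continuousM; last exact: cdg.
    by apply: continuous_comp; [exact: cg|exact: cf].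
  - by move=> n x /subD Dx; rewrite lee_fin mulr_ge0// ?f0// ltW// dg0.
rewrite DE; apply: cvg_unique L _ => //.
apply: cvg_trans Rr; apply: near_eq_cvg; apply: nearW => n.
have [Da Db] : D (a n) /\ D (b n).
  by split; apply: (@subD n); rewrite /= ?in_a ?in_b.
rewrite integration_by_substitution_increasing//.
- apply: eq_integral => x; rewrite inE => /subD Dx /=.
  by rewrite !fctE /= gE.
- move=> x xab; apply: cg'; apply: (@subD n); exact: subset_itv_oo_cc xab.
- by apply/cvg_ex; exists (derive1 g (a n)); apply: cvg_at_right_filter; exact: cg'.
- by apply/cvg_ex; exists (derive1 g (b n)); apply: cvg_at_left_filter; exact: cg'.
- split.
  + move=> x xab; apply: ex_derive; apply: dgP; apply: (@subD n).
    exact: subset_itv_oo_cc xab.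
  + by apply: cvg_at_right_filter; exact: cg.
  + by apply: cvg_at_left_filter; exact: cg.
Unshelve. all: by end_near.
Qed.

Lemma exhausted_gt0 : exhausted_by_itvs `]0, +oo[.
Proof.
split; first exact: interval_open.
exists (fun n => n.+1%:R^-1), (fun n => n.+1%:R); split.
- by move=> m n mn; rewrite lef_pV2 ?posrE// ler_nat.
- by move=> m n mn; rewrite ler_nat.
- by move=> n; rewrite (@le_trans _ _ 1)// ?invf_le1// ler1n.
- apply/seteqP; split=> [x|x [n _]]; rewrite /= !in_itv/= andbT; last first.
    by move=> /andP[+ _]; apply: lt_le_trans; rewrite invr_gt0.
  (* The sum dominates both x and 1/x, so one index serves both endpoints. *)
  move=> x0; exists (Num.truncn (x + x^-1)) => //=; rewrite in_itv/=.
  have xV0 : 0 < x^-1 by rewrite invr_gt0.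
  have /andP[_ /ltW xn] := truncn_itv (ltW (addr_gt0 x0 xV0)).
  rewrite -[leRHS]invrK lef_pV2 ?posrE// !(le_trans _ xn)//.
    by rewrite lerDl ltW.
  by rewrite lerDr ltW.
Qed.

Lemma exhausted_01 : exhausted_by_itvs `]0, 1[.
Proof.
split; first exact: interval_open.
(* Starting at 1/2 keeps the left endpoint below the right one for every n. *)
exists (fun n => n.+2%:R^-1), (fun n => 1 - n.+2%:R^-1); split.
- by move=> m n mn; rewrite lef_pV2 ?posrE// ler_nat.
- by move=> m n mn; rewrite lerD2l lerN2 lef_pV2 ?posrE// ler_nat.
- move=> n; rewrite lerBrDr (@le_trans _ _ (2^-1 + 2^-1))//; last by lra.
  by rewrite lerD// lef_pV2 ?posrE// ler_nat.
- apply/seteqP; split=> [x|x [n _]]; rewrite /= !in_itv/=; last first.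
    have : 0 < n.+2%:R^-1 :> R by rewrite invr_gt0.
    move: n.+2%:R^-1 => e e0 /andP[ex xe].
    by rewrite (lt_le_trans e0 ex) (le_lt_trans xe)// ltrBlDr ltrDl.
  move=> /andP[x0 x1]; exists (Num.truncn (x^-1 + (1 - x)^-1)) => //=; rewrite in_itv/=.
  have xV0 : 0 < x^-1 by rewrite invr_gt0.
  have yV0 : 0 < (1 - x)^-1 by rewrite invr_gt0; lra.
  have /andP[_ /ltW xn] := truncn_itv (ltW (addr_gt0 xV0 yV0)).
  set N := Num.truncn _ in xn *.
  have {}xn : x^-1 + (1 - x)^-1 <= N.+2%:R by rewrite (le_trans xn)// ler_nat.
  rewrite lerBrDl -lerBrDr -[leRHS]invrK -[X in _ && (_ <= X)]invrK.
  rewrite !lef_pV2 ?posrE ?invr_gt0 ?subr_gt0// !(le_trans _ xn)//.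
    by rewrite lerDr ltW.
  by rewrite lerDl ltW.
Qed.

Lemma exhausted_setT : exhausted_by_itvs setT.
Proof.
split; first exact: openT.
exists (fun n => - n%:R), (fun n => n%:R); split.
- by move=> m n mn; rewrite lerN2 ler_nat.
- by move=> m n mn; rewrite ler_nat.
- by move=> n; rewrite (@le_trans _ _ 0)// oppr_le0.
- apply/seteqP; split=> // x _; exists (Num.truncn `|x|).+1 => //=.
  by rewrite in_itv/= -ler_norml; have /andP[_ /ltW] := truncn_itv (normr_ge0 x).
Qed.

End substitution.

(** * Gamma and Beta integrals *)

Section power.
Context {R : realType}.
Implicit Types (r s t x y : R).

Lemma is_derive_powR r x : 0 < x ->
  is_derive x 1 (@powR R ^~ r) (r * x `^ (r - 1)).
Proof.
move=> x0; have xP : x \in `]0, +oo[%R by rewrite in_itv/= x0.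
apply: DeriveDef; first exact: derivable_powR.
by rewrite -derive1E powR_derive1.
Qed.

Lemma continuous_powR r x : 0 < x -> {for x, continuous (@powR R ^~ r)}.
Proof.
move=> x0; apply/differentiable_continuous/derivable1_diffP.
by apply: derivable_powR; rewrite in_itv/= x0.
Qed.

Lemma powR_subr1_mulr r t : 0 < t -> t `^ (r - 1) * t = t `^ r.
Proof.
move=> t0; rewrite -[X in _ * X]powRr1 ?ltW// -powRD ?subrK//.
by apply/implyP => _; rewrite gt_eqF.
Qed.

End power.

(** * Linear scaling of the half-line, and the odds substitution from ]0, 1[ to it *)

Section scaling_odds.
Context {R : realType}.
Notation mu := (@lebesgue_measure R).
Implicit Types (f : R -> R) (k r s t x y : R).
Local Notation pos := (`]0, +oo[%classic : set R).

Lemma ge0_integral_scaling f k : 0 < k -> (forall t, 0 < t -> {for t, continuous f}) ->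
  (forall t, 0 < t -> 0 <= f t) ->
  (\int[mu]_(t in `]0%R, +oo[) (f t)%:E = \int[mu]_(t in `]0%R, +oo[) (f (k * t) * k)%:E)%E.
Proof.
move=> k0 cf f0.
have posM t : pos t -> 0 < k * t.
  by rewrite /= in_itv/= andbT => t0; rewrite mulr_gt0.
transitivity (\int[mu]_(t in ( *%R k) @` pos) (f t)%:E)%E.
  congr integral; apply/seteqP; split=> [x|_ [t /posM kt0 <-]].
    rewrite /= in_itv/= andbT => x0; exists (k^-1 * x); last by rewrite mulrA divff ?mul1r ?gt_eqF.
    by rewrite /= in_itv/= andbT mulr_gt0// invr_gt0.
  by rewrite /= in_itv/= kt0.
apply: (@ge0_integration_by_substitution_image _ ( *%R k) (cst k)) => //.
- exact: exhausted_gt0.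
- move=> x x0; have -> : cst k x = k *: 1 by rewrite /cst /= /GRing.scale /= mulr1.
  exact: is_deriveZ.
- by move=> x _; exact: cvg_cst.
- by move=> x /posM; exact: cf.
- by move=> x /posM; exact: f0.
Qed.

(** The substitution inverts the odds map u / (1 - u). It moves Beta integrals to the half-line,
    where they can be compared with Gamma integrals. *)
Lemma ge0_integral_odds f : (forall u : R, 0 < u < 1 -> {for u, continuous f}) ->
  (forall u : R, 0 < u < 1 -> 0 <= f u) ->
  (\int[mu]_(u in `]0%R, 1%R[) (f u)%:E =
   \int[mu]_(t in `]0%R, +oo[) (f (t / (1 + t)) * (1 + t) ^- 2)%:E)%E.
Proof.
move=> cf f0.
have tD (t : R) : pos t -> 0 < t / (1 + t) < 1.
  rewrite /= in_itv/= andbT => t0; have t1 : 0 < 1 + t by rewrite addr_gt0.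
  by rewrite divr_gt0//= ltr_pdivrMr// mul1r ltrDr.
have t1 (t : R) : pos t -> 1 + t != 0.
  by rewrite /= in_itv/= andbT => t0; rewrite gt_eqF// addr_gt0.
pose g (t : R) := t / (1 + t).
transitivity (\int[mu]_(u in g @` pos) (f u)%:E)%E.
  congr integral; apply/seteqP; split=> [u|_ [t /tD kt0 <-]]; last by rewrite /= in_itv/=.
  rewrite /= in_itv/= => /andP[u0 u1]; exists (u / (1 - u)).
    by rewrite /= in_itv/= andbT divr_gt0// subr_gt0.
  by rewrite /g; field; rewrite subr_eq0 gt_eqF//= subrK oner_neq0.
apply: (@ge0_integration_by_substitution_image _ g (fun t => (1 + t) ^- 2)) => //.
- exact: exhausted_gt0.
- move=> t /t1 t10.
  have d1 : is_derive t 1 (fun t : R => 1 + t) (1 : R).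
    by apply: is_derive_eq (is_deriveD (is_derive_cst (1 : R) t (1 : R)) (is_derive_id t (1 : R))) _; rewrite add0r.
  have d2 := is_deriveV t10 d1.
  have := @is_deriveM _ _ _ _ _ _ _ _ (is_derive_id t 1) d2.
  move=> d3; apply: is_derive_eq d3 _.
  by rewrite /GRing.scale /=; field.
- move=> t t0; apply: continuousV; first by rewrite expf_neq0// t1.
  apply: (@continuous_comp _ _ _ (fun s : R => 1 + s) (fun s => s ^+ 2)).
    by apply: continuousD; [exact: cvg_cst|exact: cvg_id].
  exact: exprn_continuous.
- by move=> t; rewrite /= in_itv/= andbT => t0; rewrite invr_gt0 exprn_gt0// addr_gt0.
- by move=> x /tD; exact: cf.
- by move=> x /tD; exact: f0.
Qed.

End scaling_odds.

(** * The Gamma integral: finiteness, positivity, scaling *)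

Section gamma_function.
Context {R : realType}.
Notation mu := (@lebesgue_measure R).
Implicit Types (f : R -> R) (k r s t x y : R).
Local Notation pos := (`]0, +oo[%classic : set R).

Lemma pos_gt0 t : pos t -> 0 < t.
Proof. by rewrite /= in_itv/= andbT. Qed.

Lemma measurable_powR_expR r k D : measurable_fun D (fun t : R => t `^ r * expR (- (k * t))).
Proof.
apply: measurable_funTS; apply: measurable_funM; first exact: measurable_powR.
apply: measurableT_comp; first exact: measurable_expR.
by apply: measurableT_comp => //; apply: measurable_funM.
Qed.

Lemma continuous_powR_expR r k t : 0 < t ->
  {for t, continuous (fun t : R => t `^ r * expR (- (k * t)))}.
Proof.
move=> t0; apply: continuousM; first exact: continuous_powR.
apply: (@continuous_comp _ _ _ (fun t : R => - (k * t)) expR); last exact: continuous_expR.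
by apply: continuousN; apply: continuousM; [exact: cvg_cst|exact: cvg_id].
Qed.

Lemma powR_expRNE r : (fun t : R => t `^ r * expR (- t)) = (fun t => t `^ r * expR (- (1 * t))).
Proof. by apply/funext => t; rewrite mul1r. Qed.

(** Substitute v = u^x in the integral of the constant 1; the singularity at 0 for x < 1 is absorbed
    by the substitution. *)
Lemma integral_powR01 x : 0 < x ->
  (\int[mu]_(u in `]0%R, 1%R[) (u `^ (x - 1))%:E = x^-1%:E)%E.
Proof.
move=> x0; have D0 (u : R) : `]0, 1[%classic u -> 0 < u.
  by rewrite /= in_itv/= => /andP[].
have pow1 (r : R) : 1 `^ r = 1 by rewrite powR1.
have : (\int[mu]_(v in `]0%R, 1%R[) (cst 1 v)%:E =
    \int[mu]_(u in `]0%R, 1%R[) (cst 1 (u `^ x) * (x * u `^ (x - 1)))%:E)%E.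
  transitivity (\int[mu]_(v in (@powR R ^~ x) @` `]0%R, 1%R[) (cst 1 v)%:E)%E.
    congr integral; apply/seteqP; split=> [v|_ [u + <-]]; rewrite /= !in_itv/= => /andP[u0 u1].
      exists (v `^ x^-1); last by rewrite -powRrM mulVf ?gt_eqF// powRr1// ltW.
      rewrite /= in_itv/= powR_gt0//= -[ltRHS](pow1 x^-1).
      by rewrite gt0_ltr_powR ?invr_gt0// ?nnegrE// ltW.
    rewrite powR_gt0//= -[ltRHS](pow1 x).
    by rewrite gt0_ltr_powR// ?nnegrE// ltW.
  apply: (@ge0_integration_by_substitution_image _ _ (fun u => x * u `^ (x - 1))) => //.
  - exact: exhausted_01.
  - by move=> u /D0 u0; exact: is_derive_powR.
  - move=> u /D0 u0; apply: continuousM; first exact: cvg_cst.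
    exact: continuous_powR.
  - by move=> u /D0 u0; rewrite mulr_gt0// powR_gt0.
  - by move=> u _; exact: cvg_cst.
have -> : (\int[mu]_(v in `]0%R, 1%R[) (cst 1 v)%:E = 1)%E.
  transitivity (\int[mu]_(v in `]0%R, 1%R[) (cst 1%E v))%E; first by [].
  by rewrite integral_cst//= mul1e lebesgue_measure_itv/= lte_fin ltr01 -EFinB subr0.
under eq_integral do rewrite mul1r EFinM.
rewrite ge0_integralZl ?lee_fin ?(ltW x0)//; last 2 first.
- apply/measurable_EFinP; apply: measurable_funTS; exact: measurable_powR.
- by move=> u _; rewrite lee_fin powR_ge0.
move=> /(congr1 (fun z => x^-1%:E * z)%E).
by rewrite /= muleA -(EFinM x^-1 x) mulVf ?gt_eqF// mule1 mul1e.
Qed.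

Lemma integral_beta_odds x y :
  (\int[mu]_(u in `]0%R, 1%R[) (u `^ (x - 1) * (1 - u) `^ (y - 1))%:E =
   \int[mu]_(t in `]0%R, +oo[) (t `^ (x - 1) * (1 + t) `^ (- (x + y)))%:E)%E.
Proof.
rewrite (@ge0_integral_odds _ (fun u => u `^ (x - 1) * (1 - u) `^ (y - 1))).
- apply: eq_integral => t; rewrite inE => /pos_gt0 t0; congr EFin.
  have t1 : 0 < 1 + t by rewrite addr_gt0.
  have -> : 1 - t / (1 + t) = (1 + t)^-1 by field; rewrite gt_eqF.
  have powV r : (1 + t)^-1 `^ r = (1 + t) `^ (- r).
    by rewrite -powR_inv1 ?ltW// -powRrM mulN1r.
  rewrite powRM ?invr_ge0 ?ltW// !powV -powR_invn ?ltW// -!mulrA; congr (_ * _).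
  have nz r : (r == 0) ==> (1 + t != 0) by apply/implyP => _; rewrite gt_eqF.
  rewrite -!powRD ?nz//.
  by congr (_ `^ _); ring.
- move=> u /andP[u0 u1]; apply: continuousM; first exact: continuous_powR.
  apply: (@continuous_comp _ _ _ (fun u : R => 1 - u) (@powR R ^~ (y - 1))).
    by apply: continuousB; [exact: cvg_cst|exact: cvg_id].
  by apply: continuous_powR; rewrite subr_gt0.
- by move=> u _; rewrite mulr_ge0// powR_ge0.
Qed.

Definition gamma_integral x := (\int[mu]_(t in `]0%R, +oo[) (t `^ (x - 1) * expR (- t))%:E)%E.

(** A single term of the exponential series already dominates the power. *)
Lemma powR_fact_le_expR t x n : 1 <= t -> x <= n.+1%:R -> t `^ x <= n.+1`!%:R * expR t.
Proof.
move=> t1 xn; apply: (@le_trans _ _ (t ^+ n.+1)).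
  rewrite -powR_mulrn ?(le_trans _ t1)//.
  by rewrite ler_powR.
rewrite -ler_pdivrMl ?ltr0n ?fact_gt0// mulrC.
apply: le_trans (expR_ge1Dxn n _); last by rewrite (le_trans _ t1).
by rewrite lerDr.
Qed.

(** The integrand is at most a constant times t^(x - 1) (1 + t)^(-(x + 1)), the half-line form of
    the Beta(x, 1) integral, whose value is 1/x. The factor e in [C] arises because
    [powR_fact_le_expR] is applied at 1 + t. *)
Lemma gamma_integral_lty x : 0 < x -> (gamma_integral x < +oo)%E.
Proof.
move=> x0; pose n := Num.truncn (x + 1).
pose C : R := n.+1`!%:R * expR 1.
have C0 : 0 <= C by rewrite mulr_ge0// expR_ge0.
have m2 : measurable_fun pos (fun t => t `^ (x - 1) * (1 + t) `^ (- (x + 1))).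
  apply: measurable_funTS; apply: measurable_funM; first exact: measurable_powR.
  apply: (measurableT_comp (@measurable_powR R _)).
  exact: measurable_funD.
apply: (@le_lt_trans _ _ (\int[mu]_(t in `]0%R, +oo[)
    (C%:E * (t `^ (x - 1) * (1 + t) `^ (- (x + 1)))%:E))%E).
  apply: ge0_le_integral => //=.
  - by move=> t _; rewrite lee_fin mulr_ge0 ?powR_ge0 ?expR_ge0.
  - by apply/measurable_EFinP; rewrite powR_expRNE; exact: measurable_powR_expR.
  - by apply: measurable_funeM; exact/measurable_EFinP.
  - move=> t; rewrite in_itv/= andbT => t0; rewrite -EFinM lee_fin mulrCA ler_wpM2l ?powR_ge0//.
    have t1 : 0 < 1 + t by rewrite addr_gt0.
    rewrite expRN powRN ler_pdivlMr ?powR_gt0// mulrC ler_pdivrMr ?expR_gt0//.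
    rewrite /C -mulrA -expRD; apply: powR_fact_le_expR; first by rewrite lerDl ltW.
    by have /andP[_ /ltW] := truncn_itv (ltW (addr_gt0 x0 (@ltr01 R))).
rewrite ge0_integralZl//; last 2 first.
- exact/measurable_EFinP.
- by move=> t _; rewrite lee_fin mulr_ge0 ?powR_ge0.
rewrite -integral_beta_odds.
under eq_integral => u _ do rewrite subrr powRr0 mulr1.
by rewrite integral_powR01// -EFinM ltry.
Qed.

Lemma gamma_integralE x : 0 < x -> gamma_integral x = (Gamma x)%:E.
Proof.
move=> x0; rewrite /Gamma /Rintegral fineK// ge0_fin_numE ?gamma_integral_lty//.
by apply: integral_ge0 => t _; rewrite lee_fin mulr_ge0 ?powR_ge0 ?expR_ge0.
Qed.

(** Restricted to ]0, 1[, where the exponential is at least 1/e, the integral is at least 1/(e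
    x). *)
Lemma Gamma_gt0 x : 0 < x -> 0 < Gamma x.
Proof.
move=> x0; rewrite -lte_fin -gamma_integralE//.
have m1 : measurable_fun pos (fun t => (t `^ (x - 1) * expR (- t))%:E).
  by apply/measurable_EFinP; rewrite powR_expRNE; exact: measurable_powR_expR.
have sub : `]0, 1[%classic `<=` pos.
  by apply: subset_itvl; rewrite bnd_simp.
apply: (@lt_le_trans _ _ (\int[mu]_(t in `]0%R, 1%R[) ((expR (- 1))%:E * (t `^ (x - 1))%:E))%E).
  rewrite ge0_integralZl ?lee_fin ?expR_ge0//.
  - by rewrite integral_powR01// -EFinM lte_fin mulr_gt0 ?expR_gt0 ?invr_gt0.
  - apply/measurable_EFinP; apply: measurable_funTS; exact: measurable_powR.
  - by move=> u _; rewrite lee_fin powR_ge0.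
apply: (@le_trans _ _ (\int[mu]_(t in `]0%R, 1%R[) (t `^ (x - 1) * expR (- t))%:E)%E).
  apply: ge0_le_integral => //=.
  - by move=> t _; rewrite lee_fin mulr_ge0 ?powR_ge0 ?expR_ge0.
  - by apply: measurable_funeM; apply/measurable_EFinP; apply: measurable_funTS; exact: measurable_powR.
  - exact: measurable_funS m1.
  - move=> t; rewrite in_itv/= => /andP[t0 t1]; rewrite -EFinM lee_fin mulrC.
    by rewrite ler_wpM2l ?powR_ge0// ler_expR lerN2 ltW.
apply: ge0_subset_integral => //.
by move=> t _; rewrite lee_fin mulr_ge0 ?powR_ge0 ?expR_ge0.
Qed.

Lemma gamma_integral_scale x k : 0 < k ->
  (\int[mu]_(t in `]0%R, +oo[) (t `^ (x - 1) * expR (- (k * t)))%:E =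
   (k `^ (- x))%:E * gamma_integral x)%E.
Proof.
move=> k0; rewrite /gamma_integral.
rewrite (@ge0_integral_scaling _ (fun t => t `^ (x - 1) * expR (- t)) k)//; last 2 first.
- by move=> t t0; rewrite powR_expRNE; exact: continuous_powR_expR.
- by move=> t _; rewrite mulr_ge0 ?powR_ge0 ?expR_ge0.
rewrite -ge0_integralZl//; last 3 first.
- apply/measurable_EFinP.
  apply: measurable_funTS; apply: measurable_funM; last exact: measurable_cst.
  apply: measurable_funM.
    by apply: (measurableT_comp (@measurable_powR R _)); exact: measurable_funM.
  apply: (measurableT_comp (@measurable_expR R)).
  by apply: measurableT_comp => //; exact: measurable_funM.
- by move=> t _; rewrite lee_fin !mulr_ge0 ?powR_ge0 ?expR_ge0// ltW.
- by rewrite lee_fin powR_ge0.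
apply: eq_integral => t; rewrite inE => /pos_gt0 t0; rewrite -EFinM; congr EFin.
have E1 : k `^ (- x) * (k `^ (x - 1) * k) = 1.
  by rewrite powR_subr1_mulr// powRN mulVf// gt_eqF// powR_gt0.
rewrite powRM ?(ltW k0) ?(ltW t0)//.
move: (k `^ (- x)) (k `^ (x - 1)) E1 => u v E1.
by rewrite -[LHS]mul1r -E1; ring.
Qed.

End gamma_function.

(** * The Beta integral, the Gamma recurrence and the binomial series *)

Section beta_function.
Context {R : realType}.
Notation mu := (@lebesgue_measure R).
Implicit Types (f : R -> R) (k r s t x y w : R).
Local Notation pos := (`]0, +oo[%classic : set R).

Lemma tonelli_set (D : set R) (f : R -> R -> R) : measurable D ->
  measurable_fun setT (fun z : R * R => f z.1 z.2) ->
  (forall x y, 0 <= f x y) ->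
  (\int[mu]_(x in D) \int[mu]_(y in D) (f x y)%:E =
   \int[mu]_(y in D) \int[mu]_(x in D) (f x y)%:E)%E.
Proof.
move=> mD mf f0.
pose F (z : R * R) := ((fun z => (f z.1 z.2)%:E) \_ (D `*` D)) z.
have F0 z : (0 <= F z)%E.
  by rewrite /F /patch; case: ifPn => // _; rewrite lee_fin.
have mF : measurable_fun setT F.
  apply/(measurable_restrictT _ (measurableX mD mD)).
  by apply: measurable_funTS; exact/measurable_EFinP.
have := @fubini_tonelli _ _ _ _ R mu mu F mF F0.
have patchE (x y : R) : F (x, y) = if x \in D then (if y \in D then (f x y)%:E else 0%E) else 0%E.
  rewrite /F /patch in_setX /=; case: (x \in D) => //=.
set lhs := (X in X = _ -> _); set rhs := (X in _ = X -> _).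
have -> : lhs = (\int[mu]_(x in D) \int[mu]_(y in D) (f x y)%:E)%E.
  rewrite [RHS]integral_mkcond; apply: eq_integral => x _.
  rewrite /patch; case: ifPn => xD.
    by rewrite [RHS]integral_mkcond; apply: eq_integral => y _; rewrite patchE xD.
  by apply: integral0_eq => y _; rewrite patchE (negbTE xD).
have -> // : rhs = (\int[mu]_(y in D) \int[mu]_(x in D) (f x y)%:E)%E.
rewrite [RHS]integral_mkcond; apply: eq_integral => y _.
rewrite /patch; case: ifPn => yD.
  by rewrite [RHS]integral_mkcond; apply: eq_integral => x _; rewrite patchE yD.
by apply: integral0_eq => x _; rewrite patchE (negbTE yD) if_same.
Qed.

(** The double integral of [f] below is computed in both orders. Integrating in v first leaves Gamma
    x times the integrand of Gamma y; integrating in s first leaves Gamma (x + y) times the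
    half-line Beta integrand. *)
Lemma integral_beta x y : 0 < x -> 0 < y ->
  (\int[mu]_(u in `]0%R, 1%R[) (u `^ (x - 1) * (1 - u) `^ (y - 1))%:E =
   (Gamma x * Gamma y / Gamma (x + y))%:E)%E.
Proof.
move=> x0 y0; have xy0 : 0 < x + y by rewrite addr_gt0.
have mpos : measurable pos by [].
rewrite integral_beta_odds; set I := (X in X = _).
suff E : ((Gamma x * Gamma y)%:E = (Gamma (x + y))%:E * I)%E.
  rewrite EFinM E muleAC -EFinM mulfV ?mul1e//.
  by rewrite gt_eqF// Gamma_gt0.
pose f (s v : R) := s `^ (x + y - 1) * v `^ (x - 1) * expR (- ((1 + v) * s)).
have m1 : measurable_fun [set: R * R] (@fst R R) by exact: measurable_fst.
have m2 : measurable_fun [set: R * R] (@snd R R) by exact: measurable_snd.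
have mf : measurable_fun setT (fun z : R * R => f z.1 z.2).
  apply: measurable_funM; first apply: measurable_funM.
  - exact: (measurableT_comp (@measurable_powR R _)).
  - exact: (measurableT_comp (@measurable_powR R _)).
  - apply: (measurableT_comp (@measurable_expR R)).
    apply: measurable_funN; apply: measurable_funM => //.
    exact: measurable_funD.
have f0 s v : 0 <= f s v by rewrite !mulr_ge0 ?powR_ge0 ?expR_ge0.
transitivity (\int[mu]_(s in pos) \int[mu]_(v in pos) (f s v)%:E)%E.
  rewrite mulrC EFinM -(gamma_integralE x0) -(gamma_integralE y0).
  rewrite {1}/gamma_integral -ge0_integralZr//; last 3 first.
  - by apply/measurable_EFinP; rewrite powR_expRNE; exact: measurable_powR_expR.
  - by move=> t _; rewrite lee_fin mulr_ge0 ?powR_ge0 ?expR_ge0.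
  - by apply: integral_ge0 => t _; rewrite lee_fin mulr_ge0 ?powR_ge0 ?expR_ge0.
  apply: eq_integral => s; rewrite inE => /pos_gt0 s0.
  transitivity ((s `^ (x + y - 1) * expR (- s))%:E *
      \int[mu]_(t in pos) (t `^ (x - 1) * expR (- (s * t)))%:E)%E.
    rewrite gamma_integral_scale// muleA -EFinM; congr (_%:E * _)%E.
    rewrite mulrAC -powRD; last by apply/implyP => _; rewrite gt_eqF.
    by congr (_ `^ _ * _); ring.
  rewrite -ge0_integralZl//; last 3 first.
  - by apply/measurable_EFinP; exact: measurable_powR_expR.
  - by move=> t _; rewrite lee_fin mulr_ge0 ?powR_ge0 ?expR_ge0.
  - by rewrite lee_fin mulr_ge0 ?powR_ge0 ?expR_ge0.
  apply: eq_integral => t _; rewrite -EFinM; congr EFin.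
  by rewrite /f mulrACA -expRD; congr (_ * expR _); ring.
rewrite tonelli_set// /I -ge0_integralZl//; last 3 first.
- apply/measurable_EFinP; apply: measurable_funTS; apply: measurable_funM; first exact: measurable_powR.
  apply: (measurableT_comp (@measurable_powR R _)).
  exact: measurable_funD.
- by move=> t _; rewrite lee_fin mulr_ge0 ?powR_ge0.
- by rewrite lee_fin ltW// Gamma_gt0.
apply: eq_integral => v; rewrite inE => /pos_gt0 v0.
transitivity ((v `^ (x - 1))%:E *
    \int[mu]_(s in pos) (s `^ (x + y - 1) * expR (- ((1 + v) * s)))%:E)%E.
  rewrite -ge0_integralZl//; last 3 first.
  - by apply/measurable_EFinP; exact: measurable_powR_expR.
  - by move=> t _; rewrite lee_fin mulr_ge0 ?powR_ge0 ?expR_ge0.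
  - by rewrite lee_fin powR_ge0.
  by apply: eq_integral => t _; rewrite -EFinM; congr EFin; rewrite /f; ring.
rewrite gamma_integral_scale ?addr_gt0// gamma_integralE// -!EFinM; congr EFin; ring.
Qed.

(** The substitution u = 1 - e^(-t) turns the integral into that of 1 over ]0, 1[. *)
Lemma Gamma1 : Gamma 1 = 1 :> R.
Proof.
apply: EFin_inj; rewrite -gamma_integralE//.
pose g t : R := 1 - expR (- t).
transitivity (\int[mu]_(u in g @` pos) (cst 1 u)%:E)%E.
  transitivity (\int[mu]_(t in pos) (cst 1 (g t) * expR (- t))%:E)%E.
    by apply: eq_integral => t _; rewrite /= subrr powRr0.
  apply/esym/(@ge0_integration_by_substitution_image _ g (fun t => expR (- t))) => //.
  - exact: exhausted_gt0.
  - move=> t _; have dN := is_deriveN (is_derive_id t (1 : R)).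
    have dE := is_derive1_comp (is_derive_expR (- t)) dN.
    apply: is_derive_eq (is_deriveB (is_derive_cst (1 : R) t (1 : R)) dE) _.
    by rewrite sub0r mulrN1 opprK.
  - move=> t _; apply: (@continuous_comp _ _ _ (fun t : R => - t) expR).
      by apply: continuousN; exact: cvg_id.
    exact: continuous_expR.
  - by move=> t _; exact: expR_gt0.
  - by move=> t _; exact: cvg_cst.
have -> : g @` pos = `]0, 1[%classic.
  apply/seteqP; split=> [_ [t /pos_gt0 t0 <-]|u]; rewrite /= in_itv/=.
    by rewrite /g subr_gt0 expR_lt1 oppr_lt0 t0/= ltrBlDr ltrDl expR_gt0.
  move=> /andP[u0 u1]; have u1' : 0 < 1 - u by rewrite subr_gt0.
  exists (- ln (1 - u)); last by rewrite /g opprK lnK ?posrE//; ring.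
  by rewrite /= in_itv/= andbT oppr_gt0 ln_lt0// u1'/= ltrBlDr ltrDl.
transitivity ((1 : R)^-1%:E); last by rewrite invr1.
rewrite -integral_powR01//.
by apply: eq_integral => t _; rewrite subrr powRr0.
Qed.

(** Read off from the Beta(x, 1) integral, whose value is 1/x, instead of integrating by parts. *)
Lemma GammaS x : 0 < x -> Gamma (x + 1) = x * Gamma x.
Proof.
move=> x0; have := @integral_beta x 1 x0 ltr01.
under eq_integral do rewrite subrr powRr0 mulr1.
rewrite integral_powR01// Gamma1 mulr1 => /(congr1 fine)/= xV.
have G0 : Gamma (x + 1) != 0 by rewrite gt_eqF// Gamma_gt0// addr_gt0.
have -> : Gamma x = x^-1 * Gamma (x + 1) by rewrite xV divfK.
by rewrite mulrA divff ?mul1r// gt_eqF.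
Qed.

Lemma Gamma_pochhammer x n : 0 < x -> Gamma (x + n%:R) = pochhammer x n * Gamma x.
Proof.
move=> x0; rewrite /pochhammer; elim: n => [|n IH]; first by rewrite big_ord0 addr0 mul1r.
rewrite big_ord_recr/= mulrAC -IH mulrC -(@GammaS (x + n%:R)); last by rewrite ltr_wpDr.
by rewrite -addrA natr1.
Qed.

Lemma pochhammer_gt0 x n : 0 < x -> 0 < pochhammer x n.
Proof. by move=> x0; apply: prodr_gt0 => i _; rewrite ltr_wpDr. Qed.

(** After multiplication by Gamma x, the n-th coefficient involves Gamma (x + n), the integral of
    t^n against t^(x - 1) e^(-t). Summing under the integral sign produces e^(t w), hence a Gamma
    integral with rate 1 - w. *)
Lemma nneseries_binomial x w : 0 < x -> 0 <= w < 1 ->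
  (\sum_(0 <= n <oo) (pochhammer x n / n`!%:R * w ^+ n)%:E = ((1 - w) `^ (- x))%:E)%E.
Proof.
move=> x0 /andP[w0 w1].
have Gx0 := Gamma_gt0 x0.
suff E : ((\sum_(0 <= n <oo) (Gamma x * (pochhammer x n / n`!%:R * w ^+ n))%:E) =
          (Gamma x * (1 - w) `^ (- x))%:E)%E.
  have : ((Gamma x)%:E * (\sum_(0 <= n <oo) (pochhammer x n / n`!%:R * w ^+ n)%:E) =
    (Gamma x)%:E * ((1 - w) `^ (- x))%:E)%E.
    rewrite -nneseriesZl; last first.
      move=> n _; rewrite lee_fin mulr_ge0 ?exprn_ge0// divr_ge0//.
      by rewrite ltW// pochhammer_gt0.
    by under eq_eseriesr do rewrite -EFinM; rewrite E EFinM.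
  move=> /(congr1 (fun z => (Gamma x)^-1%:E * z)%E).
  by rewrite /= !muleA -!(EFinM _^-1) mulVf ?gt_eqF// !mul1e.
transitivity (\int[mu]_(t in pos) \sum_(0 <= n <oo)
    (t `^ (x - 1) * expR (- t) * ((t * w) ^+ n / n`!%:R))%:E)%E.
  rewrite integral_nneseries//; last 2 first.
  - move=> n; apply/measurable_EFinP; apply: measurable_funM.
      by rewrite powR_expRNE; exact: measurable_powR_expR.
    apply: measurable_funM => //; apply: measurable_funX.
    exact: measurable_funM.
  - move=> n t /pos_gt0 t0; rewrite lee_fin !mulr_ge0 ?powR_ge0 ?expR_ge0 ?exprn_ge0//.
    by rewrite mulr_ge0// ltW.
  apply: eq_eseriesr => n _.
  have xn0 : 0 < x + n%:R by rewrite ltr_wpDr.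
  transitivity ((w ^+ n / n`!%:R)%:E * gamma_integral (x + n%:R))%E.
    by rewrite gamma_integralE// -EFinM Gamma_pochhammer//; congr EFin; ring.
  rewrite -ge0_integralZl//; last 3 first.
  - by apply/measurable_EFinP; rewrite powR_expRNE; exact: measurable_powR_expR.
  - by move=> t _; rewrite lee_fin mulr_ge0 ?powR_ge0 ?expR_ge0.
  - by rewrite lee_fin divr_ge0 ?exprn_ge0.
  apply: eq_integral => t; rewrite inE => /pos_gt0 t0; rewrite -EFinM; congr EFin.
  rewrite (_ : x + n%:R - 1 = (x - 1) + n%:R); last by ring.
  rewrite powRD ?powR_mulrn ?(ltW t0)//; last by apply/implyP => _; rewrite gt_eqF.
  by rewrite exprMn; ring.
transitivity (\int[mu]_(t in pos) (t `^ (x - 1) * expR (- ((1 - w) * t)))%:E)%E.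
  apply: eq_integral => t; rewrite inE => /pos_gt0 t0.
  have tw0 : 0 <= t * w by rewrite mulr_ge0// ltW.
  have expRE' : (\sum_(0 <= n <oo) ((t * w) ^+ n / n`!%:R)%:E = (expR (t * w))%:E)%E.
    rewrite /expR -EFin_lim; last exact: is_cvg_series_exp_coeff.
    by congr (limn _); apply/funext => n; rewrite /= /series /= sumEFin.
  transitivity ((t `^ (x - 1) * expR (- t))%:E *
     \sum_(0 <= n <oo) ((t * w) ^+ n / n`!%:R)%:E)%E.
    rewrite -nneseriesZl; last by move=> n _; rewrite lee_fin divr_ge0 ?exprn_ge0.
    by apply: eq_eseriesr => n _; rewrite -EFinM.
  by rewrite expRE' -EFinM; congr EFin; rewrite -mulrA -expRD; congr (_ * expR _); ring.
by rewrite gamma_integral_scale ?subr_gt0// gamma_integralE// -EFinM mulrC.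
Qed.

End beta_function.

(** * The Gauss hypergeometric covariance as a mixture *)

Section mixture.
Context {R : realType}.
Notation mu := (@lebesgue_measure R).
Implicit Types (A B c m nu p q r s t u x z : R).
Local Notation pos := (`]0, +oo[%classic : set R).

(** Euler's integral with u in place of 1 - u: expand the last factor by the binomial series and
    integrate each term as a Beta integral. The endpoint z = 1 is covered because z (1 - u) < 1 for
    every u in ]0, 1[; at this stage both sides may still be infinite. *)
Lemma hyp2F1_nneseries A B p z : 0 < A -> 0 < B -> 0 < p -> 0 <= z <= 1 ->
  ((Gamma p * Gamma B / Gamma (B + p))%:E *
     \sum_(0 <= n <oo) (pochhammer A n * pochhammer B n / pochhammer (B + p) n
                        * (z ^+ n / n`!%:R))%:E =
   \int[mu]_(u in `]0%R, 1%R[)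
     (u `^ (p - 1) * (1 - u) `^ (B - 1) * (1 - z * (1 - u)) `^ (- A))%:E)%E.
Proof.
move=> A0 B0 p0 /andP[z0 z1]; have Bp0 : 0 < B + p by rewrite addr_gt0.
have poch_ge0 x n : 0 < x -> 0 <= pochhammer x n by move=> /pochhammer_gt0 /ltW.
have m1u : measurable_fun [set: R] (fun u : R => 1 - u) by exact: measurable_funB.
rewrite -nneseriesZl; last first.
  by move=> n _; rewrite lee_fin !mulr_ge0 ?invr_ge0 ?exprn_ge0// poch_ge0.
transitivity (\int[mu]_(u in `]0%R, 1%R[) \sum_(0 <= n <oo)
    (u `^ (p - 1) * (1 - u) `^ (B - 1) *
     (pochhammer A n / n`!%:R * (z * (1 - u)) ^+ n))%:E)%E.
  rewrite integral_nneseries//; last 2 first.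
  - move=> n; apply/measurable_EFinP; apply: measurable_funTS.
    apply: measurable_funM; first apply: measurable_funM.
    + exact: measurable_powR.
    + exact: (measurableT_comp (@measurable_powR R _)).
    + by apply: measurable_funM => //; apply: measurable_funX; exact: measurable_funM.
  - move=> n u; rewrite /= in_itv/= => /andP[u0 u1].
    rewrite lee_fin !mulr_ge0 ?powR_ge0 ?exprn_ge0 ?invr_ge0 ?poch_ge0//.
    by rewrite mulr_ge0// subr_ge0 ltW.
  apply: eq_eseriesr => n _; rewrite -EFinM.
  have Bn0 : 0 < B + n%:R by rewrite ltr_wpDr.
  transitivity ((pochhammer A n / n`!%:R * z ^+ n)%:E * \int[mu]_(u in `]0%R, 1%R[)
    (u `^ (p - 1) * (1 - u) `^ (B + n%:R - 1))%:E)%E.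
    rewrite integral_beta// -EFinM; congr EFin.
    rewrite (_ : p + (B + n%:R) = (B + p) + n%:R); last by ring.
    rewrite !Gamma_pochhammer//.
    have G1 : Gamma (B + p) != 0 by rewrite gt_eqF// Gamma_gt0.
    have P1 : pochhammer (B + p) n != 0 by rewrite gt_eqF// pochhammer_gt0.
    have F1 : n`!%:R != 0 :> R by rewrite pnatr_eq0 -lt0n fact_gt0.
    move: (Gamma (B + p)) G1 (pochhammer (B + p) n) P1 (n`!%:R : R) F1.
    move=> gc G1 pc P1 f F1; move: (Gamma p) (Gamma B) (pochhammer A n) => gp gB pA.
    by field; rewrite G1 P1 F1.
  rewrite -ge0_integralZl//; last 3 first.
  - apply/measurable_EFinP; apply: measurable_funTS; apply: measurable_funM.
      exact: measurable_powR.
    exact: (measurableT_comp (@measurable_powR R _)).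
  - by move=> u _; rewrite lee_fin mulr_ge0 ?powR_ge0.
  - by rewrite lee_fin mulr_ge0 ?exprn_ge0// divr_ge0// poch_ge0.
  apply: eq_integral => u; rewrite inE/= in_itv/= => /andP[u0 u1].
  rewrite -EFinM; congr EFin.
  have u1' : 0 < 1 - u by rewrite subr_gt0.
  rewrite (_ : B + n%:R - 1 = (B - 1) + n%:R); last by ring.
  rewrite (@powRD _ (1 - u) (B - 1)) ?powR_mulrn ?(ltW u1')//; last by apply/implyP => _; rewrite gt_eqF.
  by rewrite exprMn; move: ((1 - u) ^+ n) => v; ring.
apply: eq_integral => u; rewrite inE/= in_itv/= => /andP[u0 u1].
have u1' : 0 <= 1 - u by rewrite subr_ge0 ltW.
have zu : 0 <= z * (1 - u) < 1.
  rewrite mulr_ge0//= (@le_lt_trans _ _ (1 - u))// ?ler_piMl//.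
  by rewrite ltrBlDr ltrDl.
rewrite EFinM -(nneseries_binomial A0 zu) -nneseriesZl//.
by move=> n _; rewrite lee_fin !mulr_ge0 ?exprn_ge0 ?invr_ge0 ?poch_ge0// mulr_ge0.
Qed.

(** The truncated power that stands in for exp(-m x) when m is large. Since a zero base with
    exponent 0 gives 1, it vanishes beyond x = 1 only for a nonzero exponent. *)
Definition tpow m x := Num.max (1 - x) 0 `^ m.

Lemma tpow_ge0 m x : 0 <= tpow m x. Proof. exact: powR_ge0. Qed.

Lemma tpowE m x : x <= 1 -> tpow m x = (1 - x) `^ m.
Proof. by move=> x1; rewrite /tpow max_l// subr_ge0. Qed.

Lemma tpow_eq0 m x : m != 0 -> 1 <= x -> tpow m x = 0.
Proof. by move=> m0 x1; rewrite /tpow max_r ?powR0// subr_le0. Qed.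

Lemma tpow_le1 m x : 0 <= m -> 0 <= x -> tpow m x <= 1.
Proof.
move=> m0 x0; have -> : (1:R) = 1 `^ m by rewrite powR1.
rewrite ge0_ler_powR// ?nnegrE ?le_max ?lexx ?orbT//.
by rewrite ge_max gerBl x0 ler01.
Qed.

(* [mixing_weight nu q] is, up to a factor, the density of q times a Beta(nu, q - nu) variable. *)
Definition mixing_weight nu q t := t `^ (nu - 1) * tpow (q - nu - 1) (t / q).

(** Here r stands for the squared distance divided by a^2. The integral is left unnormalised: at r =
    0 the second factor is 1, so [mixture nu p q 0] is the normalising constant. *)
Definition mixture nu p q r :=
  (\int[mu]_(t in `]0%R, +oo[) (mixing_weight nu q t * tpow (p - 1) (q * r / t))%:E)%E.

Lemma mixture_beta nu p q z : 0 < q -> 1 < p -> nu + 1 < q -> 0 < z <= 1 ->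
  (mixture nu p q (1 - z) = (q `^ nu * z `^ (q - nu + p - 1))%:E *
    \int[mu]_(u in `]0%R, 1%R[)
     (u `^ (p - 1) * (1 - u) `^ (q - nu - 1) * (1 - z * (1 - u)) `^ (- (p - nu)))%:E)%E.
Proof.
move=> q0 p1 nuq /andP[z0 z1].
have p10 : p - 1 != 0 by rewrite gt_eqF// subr_gt0.
have qn0 : q - nu - 1 != 0 by rewrite gt_eqF// subr_gt0 ltrBrDl.
have z10 : 0 <= 1 - z by rewrite subr_ge0.
pose D := [set` `]q * (1 - z), q[] : set R.
have Dpos : D `<=` pos.
  move=> t; rewrite /D /= !in_itv/= andbT => /andP[+ _]; apply: le_lt_trans.
  by rewrite mulr_ge0// ltW.
pose f t := t `^ (nu - 1) * (1 - t / q) `^ (q - nu - 1) * (1 - q * (1 - z) / t) `^ (p - 1).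
transitivity (\int[mu]_(t in D) (f t)%:E)%E.
  rewrite /mixture integral_mkcond [RHS]integral_mkcond; apply: eq_integral => t _.
  rewrite /patch; case: ifPn => [|tpos].
    rewrite inE => /pos_gt0 t0; case: ifPn.
      rewrite inE /D /= in_itv/= => /andP[t1 t2].
      rewrite /mixing_weight !tpowE//.
      - by rewrite ler_pdivrMr// mul1r ltW.
      - by rewrite ler_pdivrMr// mul1r ltW.
    rewrite notin_setE /D /= in_itv/= => /negP; rewrite negb_and -!leNgt => /orP[t1|t2].
      rewrite (@tpow_eq0 (p - 1)) ?mulr0//.
      by rewrite ler_pdivlMr// mul1r.
    rewrite /mixing_weight (@tpow_eq0 (q - nu - 1)) ?mulr0 ?mul0r//.
    by rewrite ler_pdivlMr// mul1r.
  case: ifPn => // tD; move: tpos; rewrite notin_setE => tpos.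
  by have := tpos (Dpos _ (set_mem tD)).
(* The affine map of ]0, 1[ onto [D]. With s = g u / q, the bases become 1 - t/q = z (1 - u) and 1 -
   q (1 - z)/t = z u / s; collecting the powers of s gives the exponent -(p - nu). *)
pose g u := q * (1 - z * (1 - u)).
have D01 u : `]0, 1[%classic u -> 0 < u < 1 by rewrite /= in_itv.
have gE u : g u = q * (1 - z) + q * z * u by rewrite /g; ring.
have gD u : 0 < u < 1 -> D (g u).
  move=> /andP[u0 u1]; rewrite /D /= in_itv/= gE ltrDl !mulr_gt0//=.
  rewrite -gE /g gtr_pMr// ltrBlDr ltrDl mulr_gt0// subr_gt0//.
have fcont t : D t -> {for t, continuous f}.
  move=> Dt; have t0 := pos_gt0 (Dpos _ Dt); move: Dt; rewrite /D /= in_itv/= => /andP[t1 t2].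
  apply: continuousM; first apply: continuousM.
  - exact: continuous_powR.
  - apply: (@continuous_comp _ _ _ (fun t : R => 1 - t / q) (@powR R ^~ (q - nu - 1))).
      apply: continuousB; first exact: cvg_cst.
      by apply: continuousM; [exact: cvg_id|exact: cvg_cst].
    by apply: continuous_powR; rewrite subr_gt0 ltr_pdivrMr// mul1r.
  - apply: (@continuous_comp _ _ _ (fun t : R => 1 - q * (1 - z) / t) (@powR R ^~ (p - 1))).
      apply: continuousB; first exact: cvg_cst.
      apply: continuousM; first exact: cvg_cst.
      by apply: continuousV; [rewrite gt_eqF|exact: cvg_id].
    by apply: continuous_powR; rewrite subr_gt0 ltr_pdivrMr// mul1r.
transitivity (\int[mu]_(u in `]0%R, 1%R[) (f (g u) * (q * z))%:E)%E.
  have -> : D = g @` `]0, 1[%classic.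
    apply/seteqP; split=> [t|_ [u /D01 u01 <-]]; last exact: gD.
    rewrite /D /= in_itv/= => /andP[t1 t2].
    have qz0 : 0 < q * z by rewrite mulr_gt0.
    exists ((t - q * (1 - z)) / (q * z)); last by rewrite gE; field; rewrite !gt_eqF.
    rewrite /= in_itv/= divr_gt0 ?subr_gt0//= ltr_pdivrMr// mul1r ltrBlDr.
    by rewrite -mulrDr addrC subrK mulr1.
  apply: (@ge0_integration_by_substitution_image _ g (cst (q * z))) => //.
  - exact: exhausted_01.
  - move=> u _; have d1 := is_deriveZ (q * z) (is_derive_id u (1 : R)).
    have := is_deriveD (is_derive_cst (q * (1 - z)) u (1 : R)) d1.
    have -> : cst (q * (1 - z)) + (q * z) \*: id = g.
      by apply/funext => v; rewrite gE.
    by move=> d2; apply: is_derive_eq d2 _; rewrite add0r /GRing.scale /= mulr1.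
  - by move=> u _; exact: cvg_cst.
  - by move=> u _; rewrite /= mulr_gt0.
  - by move=> u /D01 u01; apply: fcont; exact: gD.
  - by move=> u _; rewrite !mulr_ge0 ?powR_ge0.
rewrite -ge0_integralZl//; last 3 first.
- apply/measurable_EFinP; apply: measurable_funTS.
  have m1u : measurable_fun [set: R] (fun u : R => 1 - u) by exact: measurable_funB.
  apply: measurable_funM; first apply: measurable_funM.
  + exact: measurable_powR.
  + exact: (measurableT_comp (@measurable_powR R _)).
  + apply: (measurableT_comp (@measurable_powR R _)).
    by apply: measurable_funB => //; exact: measurable_funM.
- by move=> u _; rewrite lee_fin !mulr_ge0 ?powR_ge0.
- by rewrite lee_fin mulr_ge0 ?powR_ge0.
apply: eq_integral => u; rewrite inE => /D01 /andP[u0 u1].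
rewrite -EFinM; congr EFin.
have u1' : 0 < 1 - u by rewrite subr_gt0.
set s := 1 - z * (1 - u).
have s0 : 0 < s.
  rewrite subr_gt0 (@le_lt_trans _ _ (1 - u))// ?ler_piMl// ?ltW//.
  by rewrite ltrBlDr ltrDl.
have nz x r : 0 < x -> (r == 0) ==> (x != 0) by move=> x0; apply/implyP => _; rewrite gt_eqF.
have -> : f (g u) = q `^ (nu - 1) * s `^ (nu - 1) *
    (z `^ (q - nu - 1) * (1 - u) `^ (q - nu - 1)) *
    (z `^ (p - 1) * u `^ (p - 1) * s `^ (- (p - 1))).
  rewrite /f /g -/s; congr (_ * _ * _).
  - by rewrite powRM ?ltW.
  - rewrite -powRM ?ltW//; congr (_ `^ _).
    by rewrite /s; field; rewrite gt_eqF.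
  - have -> : s `^ (- (p - 1)) = s^-1 `^ (p - 1) by rewrite -(powR_inv1 (ltW s0)) -powRrM mulN1r.
    have -> : 1 - q * (1 - z) / (q * s) = z * u / s.
      have -> : 1 - z = s - z * u by rewrite /s; ring.
      by move: (s) s0 => v v0; field; rewrite !gt_eqF.
    by rewrite -!powRM ?mulr_ge0 ?invr_ge0 ?ltW.
rewrite -(powR_subr1_mulr nu q0) (_ : q - nu + p - 1 = (q - nu - 1) + (p - 1) + 1); last by ring.
rewrite (_ : - (p - nu) = (nu - 1) + (- (p - 1))); last by ring.
rewrite !powRD ?nz// powRr1 ?(ltW z0)//; ring.
Qed.

End mixture.

(** * Normalisation of the mixture and its identification with the covariance *)

Section covariance_mixture.
Context {R : realType}.
Notation mu := (@lebesgue_measure R).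
Implicit Types (A B c m nu p q r s t u x z : R).
Local Notation pos := (`]0, +oo[%classic : set R).

Lemma measurable_tpow m (D : set R) (f : R -> R) : measurable_fun D f ->
  measurable_fun D (fun t => tpow m (f t)).
Proof.
move=> mf; apply: (measurableT_comp (@measurable_powR R m)).
apply: measurable_maxr => //; exact: measurable_funB.
Qed.

Lemma measurable_cst_div c : measurable_fun pos (fun t : R => c / t).
Proof.
apply: open_continuous_measurable_fun; first exact: interval_open.
move=> t; rewrite inE => /pos_gt0 t0; apply: continuousM; first exact: cvg_cst.
by apply: continuousV; [rewrite gt_eqF|exact: cvg_id].
Qed.

Lemma measurable_mixing_weight nu q (D : set R) : measurable_fun D (mixing_weight nu q).
Proof.
apply: measurable_funTS; apply: measurable_funM; first exact: measurable_powR.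
by apply: measurable_tpow; exact: measurable_funM.
Qed.

Lemma mixing_weight_ge0 nu q t : 0 <= mixing_weight nu q t.
Proof. by rewrite mulr_ge0// powR_ge0. Qed.

Lemma measurable_mixture_integrand nu p q r :
  measurable_fun pos (fun t => mixing_weight nu q t * tpow (p - 1) (q * r / t)).
Proof.
apply: measurable_funM; first exact: measurable_mixing_weight.
by apply: measurable_tpow; exact: measurable_cst_div.
Qed.

Lemma mixture_ge0 nu p q r : (0 <= mixture nu p q r)%E.
Proof. by apply: integral_ge0 => t _; rewrite lee_fin mulr_ge0 ?mixing_weight_ge0 ?tpow_ge0. Qed.

(** At z = 1 the last factor in [mixture_beta] is a power of u, and a Beta(nu, q - nu) integral
    remains. *)
Lemma mixture0 nu p q : 0 < nu -> 1 < p -> nu + 1 < q ->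
  mixture nu p q 0 = (q `^ nu * (Gamma nu * Gamma (q - nu) / Gamma q))%:E.
Proof.
move=> nu0 p1 nuq; have q0 : 0 < q by lra.
rewrite -(subrr 1) mixture_beta ?ltr01 ?lexx// powR1 mulr1 EFinM; congr (_ * _)%E.
have qn0 : 0 < q - nu by lra.
have := integral_beta nu0 qn0; rewrite (addrC nu (q - nu)) subrK => <-.
apply: eq_integral => u; rewrite inE/= in_itv/= => /andP[u0 u1]; congr EFin.
rewrite mul1r opprB addrCA subrr addr0 mulrAC -powRD; last first.
  by apply/implyP => _; rewrite gt_eqF.
by congr (_ `^ _ * _); ring.
Qed.

Lemma mixture_le nu p q r : 1 < p -> 0 < q -> 0 <= r ->
  (mixture nu p q r <= mixture nu p q 0)%E.
Proof.
move=> p1 q0 r0; apply: ge0_le_integral => //=.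
- by move=> t _; rewrite lee_fin mulr_ge0 ?mixing_weight_ge0 ?tpow_ge0.
- by apply/measurable_EFinP; exact: measurable_mixture_integrand.
- by apply/measurable_EFinP; exact: measurable_mixture_integrand.
- move=> t; rewrite in_itv/= andbT => t0; rewrite lee_fin ler_wpM2l ?mixing_weight_ge0//.
  rewrite [leRHS]tpowE ?mulr0 ?mul0r// subr0 powR1 tpow_le1//; first by lra.
  by rewrite divr_ge0 ?mulr_ge0// ltW.
Qed.

Lemma mixture_fin_num nu p q r : 0 < nu -> 1 < p -> nu + 1 < q -> 0 <= r ->
  mixture nu p q r \is a fin_num.
Proof.
move=> nu0 p1 nuq r0; rewrite ge0_fin_numE ?mixture_ge0//.
by rewrite (le_lt_trans (mixture_le nu p1 _ r0)) ?mixture0 ?ltry//; lra.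
Qed.

(** The two truncated powers live on t < q and on t > q r, which are disjoint. This is the compact
    support of the covariance. *)
Lemma mixture_eq0 nu p q r : 1 < p -> 0 < q -> nu + 1 < q -> 1 <= r -> mixture nu p q r = 0%E.
Proof.
move=> p1 q0 nuq r1; apply: integral0_eq => t /pos_gt0 t0.
have [tq|/ltW qt] := leP t q.
  rewrite (@tpow_eq0 _ (p - 1)) ?mulr0//; first by rewrite gt_eqF// subr_gt0.
  by rewrite ler_pdivlMr// mul1r (le_trans tq)// ler_peMr// ltW.
rewrite /mixing_weight (@tpow_eq0 _ (q - nu - 1)) ?mulr0 ?mul0r//.
  by rewrite gt_eqF// subr_gt0 ltrBrDl.
by rewrite ler_pdivlMr// mul1r.
Qed.

(** A real [limn] carries information only if the series converges; a finite extended sum of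
    nonnegative terms supplies both the convergence and the value. *)
Lemma lim_series_EFin (a : R^nat) (l : R) : (\sum_(0 <= n <oo) (a n)%:E = l%:E)%E ->
  (forall n, 0 <= a n) -> limn (series a) = l.
Proof.
move=> al a0; apply: cvg_lim => //.
have : (\sum_(0 <= k < n) (a k)%:E)%E @[n --> \oo] --> l%:E.
  by rewrite -al; apply: is_cvg_nneseries => n _ _; rewrite lee_fin.
by under eq_fun do rewrite sumEFin; move=> /fine_cvg.
Qed.

(** For r < 1, [hyp2F1_nneseries] and [mixture_beta] express the same integral [J] through the
    series and through the mixture; eliminating [J] gives the identity. Finiteness of the mixture
    then yields convergence of the series, including z = 1 at the origin. For r >= 1 both sides are
    0. *)
Lemma hypergeometric_mixture nu p q r : 0 < nu -> 1 < p -> nu < p -> nu + 1 < q -> 0 <= r ->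
  let z := Num.max (1 - r) 0 in let c := q - nu + p in
  Gamma p * Gamma q / (Gamma c * Gamma nu) * z `^ (c - 1) * hyp2F1 (p - nu) (q - nu) c z
  = fine (mixture nu p q r) / fine (mixture nu p q 0).
Proof.
move=> nu0 p1 nup nuq r0 z c.
have q0 : 0 < q by lra.
have qn0 : 0 < q - nu by lra.
have p0 : 0 < p by lra.
have c0 : 0 < c by rewrite addr_gt0.
have c1 : c - 1 != 0 by rewrite gt_eqF// subr_gt0 /c; lra.
rewrite [X in _ = _ / X](congr1 fine (mixture0 nu0 p1 nuq)) [X in _ = _ / X]/=.
have alg (gp gq gc gn gB Q Z M : R) : gp != 0 -> gq != 0 -> gc != 0 -> gn != 0 ->
    gB != 0 -> Q != 0 -> Z != 0 ->
    gp * gq / (gc * gn) * Z * (M / (Q * Z) / (gp * gB / gc)) = M / (Q * (gn * gB / gq)).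
  by move=> h1 h2 h3 h4 h5 h6 h7; field; rewrite h1 h2 h3 h4 h5 h6 h7.
have [r1|r1] := leP 1 r.
  rewrite mixture_eq0// [fine 0]/= mul0r.
  have -> : z = 0 by rewrite /z max_r// subr_le0.
  by rewrite powR0// mulr0 mul0r.
have zE : z = 1 - r by rewrite /z max_l// subr_ge0 ltW.
have z01 : 0 < z <= 1 by rewrite zE subr_gt0 r1 gerBl.
have z01' : 0 <= z <= 1 by case/andP : z01 => /ltW -> ->.
have z0 : 0 < z by case/andP : z01.
have -> : r = 1 - z by rewrite zE; ring.
have fN := @mixture_fin_num nu p q (1 - z) nu0 p1 nuq.
have {fN}/fineK : mixture nu p q (1 - z) \is a fin_num by apply: fN; rewrite zE; lra.
set N := fine _ => NE.
have A0 : 0 < p - nu by rewrite subr_gt0.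
have := hyp2F1_nneseries A0 qn0 p0 z01'.
have := mixture_beta q0 p1 nuq z01.
set J := (\int[mu]_(u in _) _)%E; rewrite -NE -/c => NJ SJ.
pose a n : R := pochhammer (p - nu) n * pochhammer (q - nu) n / pochhammer c n * (z ^+ n / n`!%:R).
have Q0 : q `^ nu * z `^ (c - 1) != 0 by rewrite mulf_neq0// gt_eqF// powR_gt0.
have K0 : Gamma p * Gamma (q - nu) / Gamma c != 0.
  by rewrite !mulf_neq0 ?invr_eq0 ?gt_eqF ?Gamma_gt0.
have JE : J = (N / (q `^ nu * z `^ (c - 1)))%:E.
  rewrite (mulrC N) EFinM NJ muleA -(EFinM (q `^ nu * z `^ (c - 1))^-1).
  by rewrite (mulVf Q0) mul1e.
have aE : (\sum_(0 <= n <oo) (a n)%:E =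
    (N / (q `^ nu * z `^ (c - 1)) / (Gamma p * Gamma (q - nu) / Gamma c))%:E)%E.
  by rewrite (mulrC (N / _)) EFinM -JE -SJ muleA -EFinM (mulVf K0) mul1e.
have -> : hyp2F1 (p - nu) (q - nu) c z =
    N / (q `^ nu * z `^ (c - 1)) / (Gamma p * Gamma (q - nu) / Gamma c).
  apply: (lim_series_EFin aE) => n.
  by rewrite !mulr_ge0 ?invr_ge0 ?exprn_ge0// ltW// ?pochhammer_gt0.
apply: alg; try by rewrite gt_eqF// Gamma_gt0.
- by rewrite gt_eqF// powR_gt0.
- by rewrite gt_eqF// powR_gt0.
Qed.

End covariance_mixture.

(** * The Matern covariance as a mixture *)

Section bessel.
Context {R : realType}.
Notation mu := (@lebesgue_measure R).
Implicit Types (f : R -> R) (nu r s t u w x y : R).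
Local Notation pos := (`]0, +oo[%classic : set R).

(** The classical integral for 2 r^(nu/2) K_nu(2 sqrt r), with r standing for the squared distance
    divided by 4 b^2. Unlike the Bessel integral it stays finite at r = 0 for nu > 0, with value
    Gamma nu. *)
Definition matern_mixture nu r :=
  (\int[mu]_(t in `]0%R, +oo[) (t `^ (nu - 1) * expR (- t) * expR (- (r / t)))%:E)%E.

Lemma measurable_matern_integrand nu r :
  measurable_fun pos (fun t => t `^ (nu - 1) * expR (- t) * expR (- (r / t))).
Proof.
apply: measurable_funM; first by rewrite powR_expRNE; exact: measurable_powR_expR.
apply: (measurableT_comp (@measurable_expR R)).
apply: measurable_funN; exact: measurable_cst_div.
Qed.

Lemma matern_mixture_ge0 nu r : (0 <= matern_mixture nu r)%E.
Proof. by apply: integral_ge0 => t _; rewrite lee_fin !mulr_ge0 ?powR_ge0 ?expR_ge0. Qed.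

Lemma matern_mixture_fin_num nu r : 0 < nu -> 0 <= r -> matern_mixture nu r \is a fin_num.
Proof.
move=> nu0 r0; rewrite ge0_fin_numE ?matern_mixture_ge0//.
apply: le_lt_trans (gamma_integral_lty nu0); apply: ge0_le_integral => //=.
- by move=> t _; rewrite lee_fin !mulr_ge0 ?powR_ge0 ?expR_ge0.
- by apply/measurable_EFinP; exact: measurable_matern_integrand.
- by apply/measurable_EFinP; rewrite powR_expRNE; exact: measurable_powR_expR.
- move=> t; rewrite in_itv/= andbT => t0; rewrite lee_fin ler_piMr//.
    by rewrite mulr_ge0 ?powR_ge0 ?expR_ge0.
  by rewrite expR_le1 oppr_le0 divr_ge0// ltW.
Qed.

Lemma matern_mixture0 nu : 0 < nu -> matern_mixture nu 0 = (Gamma nu)%:E.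
Proof.
move=> nu0; rewrite -(gamma_integralE nu0); apply: eq_integral => t _.
by rewrite mul0r oppr0 expR0 mulr1.
Qed.

Lemma continuous_expRM k : continuous (fun w : R => expR (k * w)).
Proof.
move=> w; apply: (@continuous_comp _ _ _ (fun w : R => k * w) expR).
  by apply: continuousM; [exact: cvg_cst|exact: cvg_id].
exact: continuous_expR.
Qed.

Lemma continuous_cosh : continuous (@cosh R).
Proof.
have -> : @cosh R = (fun t => (expR t + expR (- t)) / 2) by [].
move=> w; apply: (@continuousM _ _ (fun t => expR t + expR (- t)) (cst 2^-1)).
  apply: continuousD; first exact: continuous_expR.
  apply: (@continuous_comp _ _ _ (fun w : R => - w) expR).
    by apply: continuousN; exact: cvg_id.
  exact: continuous_expR.
exact: cvg_cst.
Qed.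

Lemma continuous_expRcosh x : continuous (fun w : R => expR (- (x * cosh w))).
Proof.
move=> w; apply: (@continuous_comp _ _ _ (fun w : R => - (x * cosh w)) expR).
  apply: continuousN; apply: continuousM; first exact: cvg_cst.
  exact: continuous_cosh.
exact: continuous_expR.
Qed.

Lemma continuous_bessel_integrand nu x :
  continuous (fun w : R => expR (- (x * cosh w)) * expR (nu * w)).
Proof.
move=> w; apply: (@continuousM _ _ (fun w : R => expR (- (x * cosh w)))
  (fun w : R => expR (nu * w))); first exact: continuous_expRcosh.
exact: continuous_expRM.
Qed.

Lemma matern_mixture_exp nu x : 0 < x ->
  (matern_mixture nu (x ^+ 2 / 4) = ((x / 2) `^ nu)%:E *
    \int[mu]_w (expR (- (x * cosh w)) * expR (nu * w))%:E)%E.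
Proof.
move=> x0; pose g w := x / 2 * expR w.
pose f t := t `^ (nu - 1) * expR (- t) * expR (- (x ^+ 2 / 4 / t)).
have x2 : 0 < x / 2 by rewrite divr_gt0.
have g0 w : 0 < g w by rewrite mulr_gt0 ?expR_gt0.
have Dg w : is_derive w 1 g (g w).
  by apply: is_derive_eq (is_deriveZ (x / 2) (is_derive_expR w)) _.
transitivity (\int[mu]_(t in g @` setT) (f t)%:E)%E.
  congr integral; apply/seteqP; split=> [t /pos_gt0 t0|_ [w _ <-]]; last first.
    by rewrite /= in_itv/= g0.
  exists (ln (t / (x / 2))) => //; rewrite /g lnK ?posrE ?divr_gt0//.
  by rewrite mulrC divfK// gt_eqF.
transitivity (\int[mu]_w (f (g w) * g w)%:E)%E.
  apply: (@ge0_integration_by_substitution_image _ g g) => //.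
  - exact: exhausted_setT.
  - move=> w _; apply: continuousM; first exact: cvg_cst.
    exact: continuous_expR.
  - move=> w _; apply: continuousM.
      by rewrite powR_expRNE; exact: continuous_powR_expR.
    apply: (@continuous_comp _ _ _ (fun t : R => - (x ^+ 2 / 4 / t)) expR).
      apply: continuousN; apply: continuousM; first exact: cvg_cst.
      by apply: continuousV; [rewrite gt_eqF|exact: cvg_id].
    exact: continuous_expR.
  - by move=> w _; rewrite !mulr_ge0 ?powR_ge0 ?expR_ge0.
rewrite -ge0_integralZl; last 4 first.
- exact: measurableT.
- apply/measurable_EFinP; apply: continuous_measurable_fun.
  exact: continuous_bessel_integrand.
- by move=> w _; rewrite lee_fin mulr_ge0 ?expR_ge0.
- by rewrite lee_fin powR_ge0.
apply: eq_integral => w _; rewrite -EFinM; congr EFin.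
have E1 : g w `^ (nu - 1) * g w = (x / 2) `^ nu * expR (nu * w).
  by rewrite powR_subr1_mulr// /g powRM ?expR_ge0 ?(ltW x2)// -expRM (mulrC w).
(* With t = (x/2) e^w, the quotient x^2/(4 t) is (x/2) e^(-w), so the two exponents add up to x cosh
   w. *)
have E2 : expR (- g w) * expR (- (x ^+ 2 / 4 / g w)) = expR (- (x * cosh w)).
  have -> : x ^+ 2 / 4 / g w = x / 2 * expR (- w).
    by rewrite /g expRN; field; rewrite !gt_eqF ?expR_gt0.
  by rewrite -expRD /g /cosh; congr expR; field.
transitivity (g w `^ (nu - 1) * g w * (expR (- g w) * expR (- (x ^+ 2 / 4 / g w)))).
  by rewrite /f; ring.
by rewrite E1 E2; ring.
Qed.

(** Fold the line at 0: cosh is even, and the two exponentials in nu w and - nu w combine into 2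
    cosh (nu w). *)
Lemma integral_expRcosh nu x :
  (\int[mu]_w (expR (- (x * cosh w)) * expR (nu * w))%:E =
   2%:E * \int[mu]_(w in `[0%R, +oo[) (expR (- (x * cosh w)) * cosh (nu * w))%:E)%E.
Proof.
pose G w := expR (- (x * cosh w)) * expR (nu * w).
have cG : continuous G by exact: continuous_bessel_integrand.
have G0 w : 0 <= G w by rewrite mulr_ge0 ?expR_ge0.
have mG (D : set R) : measurable_fun D G.
  by apply: measurable_funTS; exact: continuous_measurable_fun.
have -> : setT = `]-oo, - 0%R]%classic `|` `]0%R, +oo[%classic :> set R.
  apply/seteqP; split=> // w _; rewrite /= !in_itv/= oppr0 andbT.
  by case: (leP w 0); [left|right].
rewrite ge0_integral_setU//=; last 2 first.
- by apply/measurable_EFinP; exact: mG.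
- apply/disj_setPS => w [] /=; rewrite !in_itv/= oppr0 andbT => w0.
  by rewrite ltNge w0.
rewrite -/(G _) (ge0_integration_by_substitutionNy (G := G))//; last first.
  exact: continuous_subspaceT.
rewrite (integral_itv_obnd_cbnd (f := fun w => (G w)%:E)); last first.
  by apply/measurable_EFinP; exact: mG.
have mcosh (D : set R) : measurable_fun D (fun w => expR (- (x * cosh w)) * cosh (nu * w)).
  apply: measurable_funTS; apply: measurable_funM.
    by apply: continuous_measurable_fun; exact: continuous_expRcosh.
  apply: (measurableT_comp (continuous_measurable_fun continuous_cosh)).
  exact: measurable_funM.
have cosh_ge0 w : 0 <= cosh w :> R by rewrite divr_ge0// addr_ge0 ?expR_ge0.
rewrite -ge0_integralD//=; last 4 first.
- by move=> w _; rewrite lee_fin G0.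
- by apply/measurable_EFinP; apply: measurableT_comp.
- by move=> w _; rewrite lee_fin G0.
- by apply/measurable_EFinP; exact: mG.
rewrite -ge0_integralZl//=; last 2 first.
- by apply/measurable_EFinP; exact: mcosh.
- by move=> w _; rewrite lee_fin mulr_ge0 ?expR_ge0.
apply: eq_integral => w _; rewrite -EFinD -EFinM; congr EFin.
have coshN : cosh (- w) = cosh w :> R by rewrite /cosh opprK addrC.
by rewrite /G coshN mulrN /(cosh (nu * w)); field.
Qed.

Lemma matern_mixture_bessel nu x : 0 < nu -> 0 < x ->
  fine (matern_mixture nu (x ^+ 2 / 4)) = 2 * (x / 2) `^ nu * besselK nu x.
Proof.
move=> nu0 x0.
have c0 : 0 < 2 * (x / 2) `^ nu by rewrite mulr_gt0 ?powR_gt0 ?divr_gt0.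
have r0 : 0 <= x ^+ 2 / 4 by rewrite divr_ge0 ?exprn_ge0// ltW.
pose I := (\int[mu]_(w in `[0%R, +oo[) (expR (- (x * cosh w)) * cosh (nu * w))%:E)%E.
have ME : (matern_mixture nu (x ^+ 2 / 4) = (2 * (x / 2) `^ nu)%:E * I)%E.
  by rewrite matern_mixture_exp// integral_expRcosh muleA -EFinM (mulrC 2).
(* [fine] is multiplicative only on finite values; finiteness of the Bessel integral is inherited
   from the mixture. *)
have If : I \is a fin_num.
  have -> : (I = (2 * (x / 2) `^ nu)^-1%:E * matern_mixture nu (x ^+ 2 / 4))%E.
    by rewrite ME muleA -EFinM mulVf ?mul1e// gt_eqF.
  by rewrite fin_numM// matern_mixture_fin_num.
by rewrite ME fineM.
Qed.

End bessel.

(** * Error bounds *)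

Section truncated_power_vs_exponential.
Context {R : realType}.
Implicit Types (k m nu q t u v x y : R).

(** Equivalent to exp(x + 2 x^2) >= 1/(1 - x), which follows from (1 - x)(1 + x + 2 x^2) = 1 + x^2
    (1 - 2 x) >= 1; this is where x <= 1/2 enters. *)
Lemma expR_le_onem x : 0 <= x <= 2^-1 -> expR (- (x + 2 * x ^+ 2)) <= 1 - x.
Proof.
move=> /andP[x0 x2]; have x1 : 0 < 1 - x by lra.
rewrite expRN -[leRHS]invrK lef_pV2 ?posrE ?invr_gt0 ?expR_gt0//.
apply: le_trans (expR_ge1Dx _).
rewrite -[leLHS]mul1r ler_pdivrMr//.
nra.
Qed.

Lemma tpow_le_expR m x : 0 <= m -> 0 <= x -> tpow m x <= expR (- (m * x)).
Proof.
move=> m0 x0; rewrite (_ : - (m * x) = - x * m); last by ring.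
rewrite expRM.
have [->|m1] := eqVneq m 0.
  by rewrite /tpow !powRr0.
rewrite ge0_ler_powR ?nnegrE ?expR_ge0 ?le_max ?lexx ?orbT//.
by rewrite ge_max expR_ge0 andbT; apply: le_trans (expR_ge1Dx _); lra.
Qed.

Lemma expR_sub_tpow m x : 2 <= m -> 0 <= x ->
  `|tpow m x - expR (- (m * x))| <= 2 * m * x ^+ 2 * expR (- (m * x)).
Proof.
move=> m2 x0; rewrite distrC ger0_norm ?subr_ge0 ?tpow_le_expR//; last by lra.
set e := expR _; have e0 : 0 < e by exact: expR_gt0.
(* Beyond 1/2 the factor 2 m x^2 is at least 1 because m >= 2, so the bound follows from
   nonnegativity of the truncated power. *)
have [x2|x2] := leP x 2^-1; last first.
  have t0 := tpow_ge0 m x.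
  have : 1 <= 2 * m * x ^+ 2 by nra.
  by move=> h; nra.
rewrite tpowE; last by lra.
suff : e * (1 - 2 * m * x ^+ 2) <= (1 - x) `^ m by nra.
apply: (@le_trans _ _ (expR (- (x + 2 * x ^+ 2)) `^ m)); last first.
  rewrite ge0_ler_powR ?nnegrE ?expR_ge0//; [lra|lra|].
  by apply: expR_le_onem => //; rewrite x0.
rewrite -expRM (_ : - (x + 2 * x ^+ 2) * m = - (m * x) + - (2 * m * x ^+ 2)); last by ring.
rewrite expRD -/e ler_wpM2l ?(ltW e0)//.
exact: expR_ge1Dx.
Qed.

Lemma sqr_expRN_le u : 0 <= u -> u ^+ 2 * expR (- u) <= 4.
Proof.
move=> u0; rewrite expRN ler_pdivrMr ?expR_gt0//.
have := expR_ge1Dxn 1 u0; rewrite (_ : 2`!%:R = 2 :> R)//.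
have := expR_gt0 u; lra.
Qed.

Lemma expR_dist u v : 0 <= u -> u <= v -> `|expR (- u) - expR (- v)| <= (v - u) * expR (- u).
Proof.
move=> u0 uv; rewrite ger0_norm ?subr_ge0 ?ler_expR ?lerN2//.
rewrite (_ : - v = - u + - (v - u)); last by ring.
rewrite expRD; have := expR_ge1Dx (- (v - u)); have := expR_gt0 (- u).
nra.
Qed.

(** A mean value bound: since k >= 1/2, both exponentials are at most exp(-y/2). *)
Lemma expR_scale_dist k y : 2^-1 <= k -> 0 <= y ->
  `|expR (- (k * y)) - expR (- y)| <= `|k - 1| * y * expR (- (y / 2)).
Proof.
move=> k2 y0; have ky0 : 0 <= k * y by rewrite mulr_ge0//; lra.
have [k1|/ltW k1] := leP 1 k.
  rewrite distrC; apply: (le_trans (expR_dist y0 _)); first by rewrite ler_peMl.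
  rewrite (_ : k * y - y = (k - 1) * y); last by ring.
  rewrite ger0_norm ?subr_ge0// ler_wpM2l ?mulr_ge0 ?subr_ge0// ler_expR lerN2.
  by lra.
apply: (le_trans (expR_dist ky0 _)); first by rewrite ler_piMl.
rewrite (_ : y - k * y = (1 - k) * y); last by ring.
rewrite distrC ger0_norm ?subr_ge0// ler_wpM2l ?mulr_ge0 ?subr_ge0// ler_expR lerN2.
by rewrite mulrC ler_wpM2r.
Qed.

Lemma expR_half_le y : 0 <= y -> y * expR (- (y / 2)) <= 2.
Proof.
move=> y0; rewrite expRN ler_pdivrMr ?expR_gt0//.
have := expR_ge1Dx (y / 2); lra.
Qed.

(** Pass through exp(-m x). The first error is (2/m) (m x)^2 exp(-m x), with [sqr_expRN_le] giving
    8/m; the second is |k - 1| y exp(-y/2), with [expR_half_le] giving 2 |k - 1|. Neither depends on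
    y, hence the uniformity in the distance. *)
Lemma tpow_expR_dist_le m k x y : 2 <= m -> 0 <= x -> m * x = k * y -> 2^-1 <= k -> 0 <= y ->
  `|tpow m x - expR (- y)| <= 8 / m + 2 * `|k - 1|.
Proof.
move=> m2 x0 mxky k2 y0; have m0 : 0 < m by lra.
apply: (le_trans (ler_distD (expR (- (m * x))) _ _)); apply: lerD.
  apply: (le_trans (expR_sub_tpow m2 x0)).
  have mx0 : 0 <= m * x by rewrite mulr_ge0// ltW.
  rewrite ler_pdivlMr//; have := sqr_expRN_le mx0; rewrite exprMn; lra.
rewrite mxky; apply: (le_trans (expR_scale_dist k2 y0)).
by rewrite -mulrA mulrC ler_wpM2r// expR_half_le.
Qed.

(** The same comparison with m = q - nu - 1, x = t/q and k = m/q = 1 - (nu + 1)/q, but keeping the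
    decay exp(-t/2) so that the bound can be integrated against t^(nu - 1). The two lower bounds on
    q give m >= 2 and k >= 1/2. *)
Lemma mixing_weight_dist nu q t : 0 < nu -> nu + 3 <= q -> 2 * (nu + 1) <= q -> 0 < t ->
  `|mixing_weight nu q t - t `^ (nu - 1) * expR (- t)| <=
  8 / (q - nu - 1) * (t `^ (nu + 2 - 1) * expR (- (2^-1 * t))) +
  (nu + 1) / q * (t `^ (nu + 1 - 1) * expR (- (2^-1 * t))).
Proof.
move=> nu0 q3 q2 t0.
have q0 : 0 < q by lra.
set m := q - nu - 1; have m2 : 2 <= m by rewrite /m; lra.
pose k := m / q; have kE : k - 1 = - ((nu + 1) / q) by rewrite /k /m; field; rewrite gt_eqF.
have k2 : 2^-1 <= k by rewrite /k ler_pdivlMr// /m; lra.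
have k1 : k <= 1 by rewrite /k ler_pdivrMr// /m; lra.
have mt : m * (t / q) = k * t by rewrite /k; field; rewrite gt_eqF.
rewrite -mulrBr normrM (ger0_norm (powR_ge0 _ _)).
have -> : t `^ (nu + 2 - 1) = t `^ (nu - 1) * t ^+ 2.
  rewrite -powR_mulrn ?ltW// -powRD; last by apply/implyP => _; rewrite gt_eqF.
  by congr (_ `^ _); ring.
have -> : t `^ (nu + 1 - 1) = t `^ (nu - 1) * t.
  by rewrite powR_subr1_mulr// addrK.
set P := t `^ (nu - 1); set e := expR (- (2^-1 * t)).
rewrite (_ : 8 / m * _ + _ = P * (8 / m * t ^+ 2 * e + (nu + 1) / q * t * e)); last by ring.
rewrite ler_wpM2l ?powR_ge0//.
apply: (le_trans (ler_distD (expR (- (m * (t / q)) : R)) _ _)); apply: lerD.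
  have tq0 : 0 <= t / q by rewrite divr_ge0 ?ltW.
  apply: (le_trans (expR_sub_tpow m2 tq0)).
  have e12 : expR (- (m * (t / q))) <= e.
    by rewrite ler_expR lerN2 mt ler_wpM2r// ltW.
  have m0 : 0 < m by lra.
  have -> : 2 * m * (t / q) ^+ 2 = 2 * k ^+ 2 * t ^+ 2 / m.
    by rewrite /k; field; rewrite !gt_eqF.
  have k2' : k ^+ 2 <= 1 by rewrite expr_le1//; lra.
  apply: ler_pM => //; rewrite ?expR_ge0//.
    by rewrite divr_ge0 ?(ltW m0)// mulr_ge0 ?sqr_ge0// mulr_ge0 ?sqr_ge0.
  rewrite [leRHS]mulrAC ler_pM2r ?invr_gt0//; have := sqr_ge0 t; nra.
rewrite mt; apply: (le_trans (expR_scale_dist k2 (ltW t0))).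
rewrite kE normrN ger0_norm; last by rewrite divr_ge0//; lra.
by rewrite (mulrC t 2^-1).
Qed.

End truncated_power_vs_exponential.

(** * From pointwise bounds to a bound on normalised mixtures *)

Section limit.
Context {R : realType}.
Notation mu := (@lebesgue_measure R).
Implicit Types (f g h : R -> R) (k nu p q r t u x y : R).
Local Notation pos := (`]0, +oo[%classic : set R).

(** Two one-sided comparisons, f <= g + h and g <= f + h, keep every integrand nonnegative; the
    signed difference is formed only after finiteness. *)
Lemma integral_dist_le (D : set R) f g h : measurable D ->
  measurable_fun D f -> measurable_fun D g -> measurable_fun D h ->
  (forall t, D t -> 0 <= f t) -> (forall t, D t -> 0 <= g t) ->
  (forall t, D t -> `|f t - g t| <= h t) ->
  ((\int[mu]_(t in D) (f t)%:E)%E \is a fin_num) ->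
  ((\int[mu]_(t in D) (g t)%:E)%E \is a fin_num) ->
  ((\int[mu]_(t in D) (h t)%:E)%E \is a fin_num) ->
  `|fine (\int[mu]_(t in D) (f t)%:E)%E - fine (\int[mu]_(t in D) (g t)%:E)%E|
    <= fine (\int[mu]_(t in D) (h t)%:E)%E.
Proof.
move=> mD.
have main f1 f2 : measurable_fun D f1 -> measurable_fun D f2 -> measurable_fun D h ->
    (forall t, D t -> 0 <= f1 t) -> (forall t, D t -> 0 <= f2 t) ->
    (forall t, D t -> `|f1 t - f2 t| <= h t) ->
    (\int[mu]_(t in D) (f1 t)%:E <=
     \int[mu]_(t in D) (f2 t)%:E + \int[mu]_(t in D) (h t)%:E)%E.
  move=> mf1 mf2 mh f10 f20 fh.
  have h0 t : D t -> 0 <= h t by move=> /fh; apply: le_trans.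
  rewrite -ge0_integralD//; last 2 first.
  - exact/measurable_EFinP.
  - exact/measurable_EFinP.
  apply: ge0_le_integral => //.
  - exact/measurable_EFinP.
  - by apply/measurable_EFinP; exact: measurable_funD.
  - move=> t Dt; rewrite -EFinD lee_fin; have := fh t Dt.
    by rewrite ler_norml => /andP[_]; lra.
move=> mf mg mh f0 g0 fh If Ig Ih.
have h1 := main _ _ mf mg mh f0 g0 fh.
have h2 : (\int[mu]_(t in D) (g t)%:E <=
    \int[mu]_(t in D) (f t)%:E + \int[mu]_(t in D) (h t)%:E)%E.
  by apply: main => // t Dt; rewrite distrC fh.
move: h1 h2; rewrite -(fineK If) -(fineK Ig) -(fineK Ih) -!EFinD !lee_fin /= => h1 h2.
by rewrite ler_norml; apply/andP; split; lra.
Qed.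

(** The integral over the half-line of the bound in [mixing_weight_dist], of order 1/q; the powers
    of 1/2 come from the rate 1/2 in the exponentials. *)
Definition weight_error nu q : R :=
  8 / (q - nu - 1) * (2^-1 `^ (- (nu + 2)) * Gamma (nu + 2)) +
  (nu + 1) / q * (2^-1 `^ (- (nu + 1)) * Gamma (nu + 1)).

Lemma mixture_dist nu p q k r y : 0 < nu -> 3 <= p -> nu + 3 <= q -> 2 * (nu + 1) <= q ->
  0 <= r -> 0 <= y -> 2^-1 <= k -> (p - 1) * (q * r) = k * y ->
  `|fine (mixture nu p q r) - fine (matern_mixture nu y)| <=
  weight_error nu q + (8 / (p - 1) + 2 * `|k - 1|) * Gamma nu.
Proof.
move=> nu0 p3 q3 q2 r0 y0 k2 kE.
have q0 : 0 < q by lra.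
have p1 : 1 < p by lra.
have nuq : nu + 1 < q by lra.
pose d : R := 8 / (p - 1) + 2 * `|k - 1|.
have d0 : 0 <= d by rewrite addr_ge0 ?mulr_ge0 ?invr_ge0//; lra.
have m0 : 0 <= 8 / (q - nu - 1) by rewrite divr_ge0//; lra.
have n0 : 0 <= (nu + 1) / q by rewrite divr_ge0//; lra.
pose h1 t := 8 / (q - nu - 1) * (t `^ (nu + 2 - 1) * expR (- (2^-1 * t))).
pose h2 t := (nu + 1) / q * (t `^ (nu + 1 - 1) * expR (- (2^-1 * t))).
pose h3 t := d * (t `^ (nu - 1) * expR (- t)).
have I1 : (\int[mu]_(t in pos) (h1 t + h2 t + h3 t)%:E =
    (weight_error nu q + d * Gamma nu)%:E)%E.
  have powexp0 s c : 0 <= s `^ c * expR (- (2^-1 * s)) :> R by rewrite mulr_ge0 ?powR_ge0 ?expR_ge0.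
  have powexp1 s c : 0 <= s `^ c * expR (- s) :> R by rewrite mulr_ge0 ?powR_ge0 ?expR_ge0.
  have mpe c : measurable_fun pos (fun s : R => (s `^ c * expR (- (2^-1 * s)))%:E).
    by apply/measurable_EFinP; exact: measurable_powR_expR.
  have mpe1 c : measurable_fun pos (fun s : R => (s `^ c * expR (- s))%:E).
    by apply/measurable_EFinP; rewrite powR_expRNE; exact: measurable_powR_expR.
  transitivity (\int[mu]_(t in pos)
    ((8 / (q - nu - 1))%:E * (t `^ (nu + 2 - 1) * expR (- (2^-1 * t)))%:E +
     ((nu + 1) / q)%:E * (t `^ (nu + 1 - 1) * expR (- (2^-1 * t)))%:E +
     d%:E * (t `^ (nu - 1) * expR (- t))%:E))%E.
    by apply: eq_integral => t _; rewrite -!EFinM -!EFinD.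
  rewrite ge0_integralD//=; last 4 first.
  - by move=> t _; rewrite adde_ge0// mule_ge0// lee_fin.
  - by apply: emeasurable_funD; apply: measurable_funeM; exact: mpe.
  - by move=> t _; rewrite mule_ge0// lee_fin.
  - by apply: measurable_funeM; exact: mpe1.
  rewrite ge0_integralD//=; last 4 first.
  - by move=> t _; rewrite mule_ge0// lee_fin.
  - by apply: measurable_funeM; exact: mpe.
  - by move=> t _; rewrite mule_ge0// lee_fin.
  - by apply: measurable_funeM; exact: mpe.
  rewrite !ge0_integralZl ?lee_fin//; try by move=> t _; rewrite lee_fin.
  rewrite (@gamma_integral_scale R (nu + 2) 2^-1)// (@gamma_integral_scale R (nu + 1) 2^-1)//.
  rewrite -/(gamma_integral nu) (@gamma_integralE R (nu + 2)) ?addr_gt0//.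
  rewrite (@gamma_integralE R (nu + 1)) ?addr_gt0// (@gamma_integralE R nu)//.
  - exact: mpe1.
  - exact: mpe.
  - exact: mpe.
have mh : measurable_fun pos (fun t => h1 t + h2 t + h3 t).
  apply: measurable_funD; first apply: measurable_funD.
  - by apply: measurable_funM => //; exact: measurable_powR_expR.
  - by apply: measurable_funM => //; exact: measurable_powR_expR.
  - by apply: measurable_funM => //; rewrite powR_expRNE; exact: measurable_powR_expR.
have -> : weight_error nu q + d * Gamma nu =
    fine (\int[mu]_(t in pos) (h1 t + h2 t + h3 t)%:E)%E by rewrite I1.
apply: integral_dist_le => //.
- exact: measurable_mixture_integrand.
- exact: measurable_matern_integrand.
- by move=> t _; rewrite mulr_ge0 ?mixing_weight_ge0 ?tpow_ge0.
- by move=> t _; rewrite !mulr_ge0 ?powR_ge0 ?expR_ge0.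
- move=> t /pos_gt0 t0.
  have x0 : 0 <= q * r / t by rewrite divr_ge0 ?mulr_ge0// ltW.
  have y0' : 0 <= y / t by rewrite divr_ge0// ltW.
  have W := mixing_weight_dist nu0 q3 q2 t0.
  have P : `|tpow (p - 1) (q * r / t) - expR (- (y / t))| <= d.
    apply: tpow_expR_dist_le => //; first by lra.
    by rewrite mulrA kE mulrA.
  have t1 : tpow (p - 1) (q * r / t) <= 1 by rewrite tpow_le1//; lra.
  have t2 := tpow_ge0 (p - 1) (q * r / t).
  set w := t `^ (nu - 1) * expR (- t) in W *.
  have w0 : 0 <= w by rewrite mulr_ge0 ?powR_ge0 ?expR_ge0.
  (* Change the weight first, with the truncated power bounded by 1, and then the integrand under
     the limit weight. *)
  rewrite (_ : _ - _ = (mixing_weight nu q t - w) * tpow (p - 1) (q * r / t) +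
    w * (tpow (p - 1) (q * r / t) - expR (- (y / t)))); last by ring.
  apply: (le_trans (ler_normD _ _)); rewrite (normrM w) (normrM (_ - w)) (ger0_norm t2) (ger0_norm w0).
  apply: lerD; last by rewrite /h3 -/w mulrC ler_wpM2r.
  by apply: le_trans W; rewrite ler_piMr.
- exact: mixture_fin_num.
- exact: matern_mixture_fin_num.
- by rewrite I1.
Qed.

(** The difference is (N - M)/G + (N/Z) (G - Z)/G with N/Z <= 1, so the error is measured against
    the fixed limit constant G alone. *)
Lemma ratio_dist_le (N Z M G e : R) : 0 <= N -> N <= Z -> 0 < Z -> 0 < G ->
  `|N - M| <= e -> `|Z - G| <= e -> `|N / Z - M / G| <= 2 * (e / G).
Proof.
move=> N0 NZ Z0 G0 NM ZG.
rewrite (_ : N / Z - M / G = (N - M) / G + (N / Z) * ((G - Z) / G)); last first.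
  by field; rewrite !gt_eqF.
have NZ1 : N / Z <= 1 by rewrite ler_pdivrMr// mul1r.
have NZ0 : 0 <= N / Z by rewrite divr_ge0// ltW.
have GV0 : 0 <= G^-1 by rewrite invr_ge0 ltW.
apply: (le_trans (ler_normD _ _)).
rewrite (normrM (N / Z)) (ger0_norm NZ0) !normrM (ger0_norm GV0) (distrC G).
rewrite (_ : 2 * _ = e / G + 1 * (e / G)); last by ring.
apply: lerD; first by rewrite ler_wpM2r.
apply: ler_pM => //; first by rewrite mulr_ge0.
by rewrite ler_wpM2r.
Qed.

Lemma mixture_ratio_dist nu p q k r y : 0 < nu -> 3 <= p -> nu + 3 <= q -> 2 * (nu + 1) <= q ->
  0 <= r -> 0 <= y -> 2^-1 <= k -> (p - 1) * (q * r) = k * y ->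
  `|fine (mixture nu p q r) / fine (mixture nu p q 0) -
    fine (matern_mixture nu y) / Gamma nu| <=
  2 * ((weight_error nu q + (8 / (p - 1) + 2 * `|k - 1|) * Gamma nu) / Gamma nu).
Proof.
move=> nu0 p3 q3 q2 r0 y0 k2 kE.
have q0 : 0 < q by lra.
have p1 : 1 < p by lra.
have nuq : nu + 1 < q by lra.
have qn0 : 0 < q - nu by lra.
have G0 := Gamma_gt0 nu0.
have fN := mixture_fin_num nu0 p1 nuq r0.
have fZ := mixture_fin_num nu0 p1 nuq (lexx 0).
have N0 : 0 <= fine (mixture nu p q r) by exact: fine_ge0 (mixture_ge0 _ _ _ _).
have NZ := fine_le fN fZ (mixture_le nu p1 q0 r0).
have Z0 : 0 < fine (mixture nu p q 0).
  rewrite mixture0 // [X in 0 < X]/= mulr_gt0 ?powR_gt0 //.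
  by rewrite divr_gt0 ?mulr_gt0 ?Gamma_gt0.
have D1 := mixture_dist nu0 p3 q3 q2 r0 y0 k2 kE.
(* The normalising constants are compared by the same lemma at r = y = 0, where the scaling relation
   holds with the same k. *)
have kE0 : (p - 1) * (q * 0) = k * 0 by rewrite !mulr0.
have := mixture_dist nu0 p3 q3 q2 (lexx 0) (lexx 0) k2 kE0.
rewrite matern_mixture0 //; exact: ratio_dist_le N0 NZ Z0 G0 D1.
Qed.

End limit.

(** * Convergence *)

Section covariances.
Context {R : realType} {d : nat}.
Implicit Types (h : 'rV[R]_d) (a alpha b beta gamma nu : R).

Lemma enorm_ge0 h : 0 <= enorm h. Proof. exact: sqrtr_ge0. Qed.

Lemma enorm_eq0 h : (enorm h == 0) = (h == 0).
Proof.
have s0 : 0 <= \sum_(i < d) h ord0 i ^+ 2 by apply: sumr_ge0 => i _; exact: sqr_ge0.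
rewrite sqrtr_eq0; apply/idP/eqP => [h0|->]; last first.
  by rewrite big1// => i _; rewrite mxE expr0n.
have /eqP : \sum_(i < d) h ord0 i ^+ 2 == 0 by rewrite eq_le h0.
move=> /psumr_eq0P hi; apply/rowP => i; rewrite mxE; apply/eqP.
by rewrite -sqrf_eq0 hi// => j _; exact: sqr_ge0.
Qed.

Lemma matern_cov_mixture b nu h : 0 < b -> 0 < nu ->
  matern_cov b nu h = fine (matern_mixture nu (enorm h ^+ 2 / (4 * b ^+ 2))) / Gamma nu.
Proof.
move=> b0 nu0; rewrite /matern_cov; have G0 := Gamma_gt0 nu0.
case: ifPn => [|h0].
  rewrite -enorm_eq0 => /eqP ->; rewrite expr0n mul0r matern_mixture0//=.
  by rewrite divff// gt_eqF.
have x0 : 0 < enorm h / b.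
  by rewrite divr_gt0// lt_neqAle enorm_ge0 eq_sym enorm_eq0 h0.
have -> : enorm h ^+ 2 / (4 * b ^+ 2) = (enorm h / b) ^+ 2 / 4.
  by field; rewrite gt_eqF.
rewrite matern_mixture_bessel//.
have -> : enorm h / (2 * b) = enorm h / b / 2 by field; rewrite gt_eqF.
by field; rewrite gt_eqF.
Qed.

Lemma hypergeometric_cov_mixture a alpha beta gamma h :
  let nu := alpha - d%:R / 2 in let p := beta - d%:R / 2 in let q := gamma - d%:R / 2 in
  0 < nu -> 1 < p -> nu < p -> nu + 1 < q ->
  hypergeometric_cov a alpha beta gamma h =
  fine (mixture nu p q (enorm h ^+ 2 / a ^+ 2)) / fine (mixture nu p q 0).
Proof.
move=> nu p q nu0 p1 nup nuq.
have r0 : 0 <= enorm h ^+ 2 / a ^+ 2 by rewrite divr_ge0 ?sqr_ge0.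
rewrite -hypergeometric_mixture// /hypergeometric_cov -/p -/q -/nu.
have -> : beta - alpha = p - nu by rewrite /p /nu; ring.
have -> : gamma - alpha = q - nu by rewrite /q /nu; ring.
by have -> : p - nu + gamma - d%:R / 2 = q - nu + p by rewrite /q; ring.
Qed.

End covariances.

(** * Uniform convergence and elementary limits along a filter *)

Section convergence.
Context {R : realType} {T : Type} {F : set_system T} {FF : ProperFilter F}.

Lemma near_dist_uniform_cvg (U : choiceType) (f : T -> U -> R) (g : U -> R) :
  (forall e : R, 0 < e -> \forall t \near F, forall u, `|g u - f t u| < e) ->
  {uniform, f @ F --> g}.
Proof.
move=> fg P /uniform_nbhs[E [+ EP]]; rewrite -entourage_ballE => -[e /= e0 eE].
apply: filterS (fg e e0) => t gt; apply: EP => u _; apply: eE.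
exact: gt.
Qed.

Lemma cvg_inv_shift (f : T -> R) (c : R) : f t @[t --> F] --> +oo ->
  (f t - c)^-1 @[t --> F] --> (0 : R).
Proof.
move=> /cvgryPge foo; apply/gtr0_cvgV0.
  by apply: filterS (foo (c + 1)) => t; lra.
apply/cvgryPge => A; apply: filterS (foo (A + c)) => t; lra.
Qed.

Lemma cvg_shift_ratio (f : T -> R) (c : R) : f t @[t --> F] --> +oo ->
  (f t - c) / f t @[t --> F] --> (1 : R).
Proof.
move=> foo; have f0 : (f t - 0)^-1 @[t --> F] --> (0 : R) by exact: cvg_inv_shift.
have L : 1 - c * (f t - 0)^-1 @[t --> F] --> (1 - c * 0 : R).
  apply: cvgB; first exact: cvg_cst.
  by apply: cvgM; [exact: cvg_cst|exact: f0].
rewrite mulr0 subr0 in L; apply: cvg_trans L; apply: near_eq_cvg.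
move/cvgryPge : foo => /(_ 1); apply: filterS => t f1.
by rewrite subr0; field; rewrite gt_eqF//; lra.
Qed.

End convergence.

Theorem theorem11 (R : realType) (d : nat) (alpha b : R)
    (hd : (1 <= d)%N) (halpha : d%:R / 2 < alpha) (hb : 0 < b)
    (T : Type) (F : set_system T) (FF : ProperFilter F) (a beta gamma : T -> R)
    (ha : a t @[t --> F] --> +oo)
    (hbeta : beta t @[t --> F] --> +oo)
    (hgamma : gamma t @[t --> F] --> +oo)
    (hab : a t / (2 * Num.sqrt (beta t * gamma t)) @[t --> F] --> b) :
  {uniform, (fun t : T =>
      hypergeometric_cov (a t) alpha (beta t) (gamma t) : 'rV[R]_d -> R) @ F
    --> (matern_cov b (alpha - d%:R / 2) : 'rV[R]_d -> R)}.
Proof.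
set nu := alpha - d%:R / 2; have nu0 : 0 < nu by rewrite subr_gt0.
have G0 := Gamma_gt0 nu0.
pose c : R := d%:R / 2.
pose p t := beta t - c; pose q t := gamma t - c.
(* The factor for which (p - 1) q (|h|^2 / a^2) = k |h|^2 / (4 b^2) holds for every [h]. *)
pose k t := 4 * b ^+ 2 * (p t - 1) * q t / a t ^+ 2.
have kcvg : k t @[t --> F] --> (1 : R).
  pose u t := a t / (2 * Num.sqrt (beta t * gamma t)).
  (* Since u^2 = a^2 / (4 beta gamma), this product equals k as soon as a, beta and gamma are
     positive; the last two factors are the shifts p - 1 and q relative to beta and gamma. *)
  have L : b ^+ 2 / (u t * u t) * ((beta t - (c + 1)) / beta t) * ((gamma t - c) / gamma t)
      @[t --> F] --> (b ^+ 2 / (b * b) * 1 * 1 : R).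
    apply: cvgM; last exact: cvg_shift_ratio.
    apply: cvgM; last exact: cvg_shift_ratio.
    apply: cvgM; first exact: cvg_cst.
    by apply: cvgV; [rewrite mulf_neq0// gt_eqF|exact: cvgM].
  rewrite !mulr1 -expr2 divff ?expf_neq0 ?gt_eqF// in L.
  apply: cvg_trans L; apply: near_eq_cvg.
  move/cvgryPge : ha => /(_ 1) ha; move/cvgryPge : hbeta => /(_ 1) hbeta.
  move/cvgryPge : hgamma => /(_ 1) hgamma.
  near=> t.
  have a1 : 1 <= a t by near: t.
  have b1 : 1 <= beta t by near: t.
  have g1 : 1 <= gamma t by near: t.
  have uu : u t * u t = a t ^+ 2 / (4 * (beta t * gamma t)).
    have bg0 : 0 < beta t * gamma t by rewrite mulr_gt0//; lra.
    rewrite -(sqr_sqrtr (ltW bg0)) /u; field.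
    by rewrite gt_eqF// sqrtr_gt0.
  rewrite uu /k /p /q; field; rewrite !gt_eqF//; lra.
(* The right-hand side of [mixture_ratio_dist]. It does not involve [h], so its convergence to 0 is
   all that uniform convergence requires. *)
pose E t := 2 * ((weight_error nu (q t) + (8 / (p t - 1) + 2 * `|k t - 1|) * Gamma nu) / Gamma nu).
have Ecvg : E t @[t --> F] --> (0 : R).
  have qcvg : (q t - nu - 1)^-1 @[t --> F] --> (0 : R).
    rewrite (_ : (fun t => _) = fun t => (gamma t - (c + (nu + 1)))^-1).
      exact: cvg_inv_shift.
    by apply/funext => t; congr (_^-1); rewrite /q; ring.
  have pcvg : (p t - 1)^-1 @[t --> F] --> (0 : R).
    rewrite (_ : (fun t => _) = fun t => (beta t - (c + 1))^-1).
      exact: cvg_inv_shift.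
    by apply/funext => t; congr (_^-1); rewrite /p; ring.
  have wcvg : weight_error nu (q t) @[t --> F] -->
      8 * 0 * (2^-1 `^ (- (nu + 2)) * Gamma (nu + 2)) +
      (nu + 1) * 0 * (2^-1 `^ (- (nu + 1)) * Gamma (nu + 1)).
    apply: cvgD; (apply: cvgM; last exact: cvg_cst); (apply: cvgM; first exact: cvg_cst).
      exact: qcvg.
    exact: cvg_inv_shift.
  have ncvg : `|k t - 1| @[t --> F] --> `|1 - 1 : R|.
    by apply: cvg_norm; apply: cvgB => //; exact: cvg_cst.
  have L : E t @[t --> F] --> 2 * ((8 * 0 * (2^-1 `^ (- (nu + 2)) * Gamma (nu + 2)) +
      (nu + 1) * 0 * (2^-1 `^ (- (nu + 1)) * Gamma (nu + 1)) +
      (8 * 0 + 2 * `|1 - 1 : R|) * Gamma nu) / Gamma nu).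
    apply: cvgM; first exact: cvg_cst.
    apply: cvgM; last exact: cvg_cst.
    apply: cvgD; first exact: wcvg.
    apply: cvgM; last exact: cvg_cst.
    by apply: cvgD; (apply: cvgM; first exact: cvg_cst).
  by rewrite subrr normr0 !(mulr0, mul0r, addr0) in L.
apply: near_dist_uniform_cvg => e e0.
have Ee : \forall t \near F, E t < e.
  by apply: cvgr_lt Ecvg _ e0.
have k2 : \forall t \near F, 2^-1 <= k t.
  by apply: cvgr_ge kcvg _ _; lra.
move/cvgryPge : ha => ha; move/cvgryPge : hbeta => hbeta; move/cvgryPge : hgamma => hgamma.
near=> t => h.
have a1 : 1 <= a t by near: t; exact: ha.
(* Summed thresholds: as nu > 0, this one implies both 3 <= p and nu < p, and the next one both nu +
   3 <= q and 2 (nu + 1) <= q. *)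
have p3 : 3 + nu <= p t.
  by rewrite /p lerBrDr; near: t; exact: hbeta.
have q3 : 3 + 2 * (nu + 1) <= q t.
  by rewrite /q lerBrDr; near: t; exact: hgamma.
apply: (@le_lt_trans _ _ (E t)); last by near: t.
rewrite matern_cov_mixture// hypergeometric_cov_mixture -/nu -/c -/(p t) -/(q t)//; [|lra|lra|lra].
rewrite distrC; apply: mixture_ratio_dist => //; [lra|lra|lra| | | |].
- by rewrite divr_ge0 ?sqr_ge0.
- by apply: divr_ge0; [exact: sqr_ge0|apply: mulr_ge0 => //; exact: sqr_ge0].
- by near: t.
- by rewrite /k; field; rewrite !gt_eqF//; lra.
Unshelve. all: by end_near.
Qed.
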